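(* Let $\Gamma$ be a metric graph, $D$ a divisor on $\Gamma$, and $M\subset\mathrm{Rat}(D)$ an admissible semimodule. Then $M$ determines its underlying slope structure uniquely: if $\mathfrak S$ and $\mathfrak S'$ are slope structures on $\Gamma$, of widths $r$ and $r'$ respectively, such that $M$ is admissible of rank $r$ with underlying slope structure $\mathfrak S$ and admissible of rank $r'$ with underlying slope structure $\mathfrak S'$, then $\mathfrak S=\mathfrak S'$.
   Context: Metric graphs. A metric graph $\Gamma$ is the metric realization of a pair $(G,\ell)$, where $G=(V,E)$ is a finite connected graph with at least one edge and $\ell\colon E\to\mathbb R_{>0}$: each edge $e$ is replaced by a closed interval of length $\ell(e)$, glued according to $G$, with the path metric. $G$ (with $\ell$) is called a model of $\Gamma$; a model is simple if it has no loops and no parallel edges. $\mathrm T_x(\Gamma)$ is the finite set of outgoing unit tangent vectors at $x$, and $d_x=|\mathrm T_x(\Gamma)|$. $\mathrm{Rat}(\Gamma)$ is the set of continuous piecewise affine functions $f\colon\Gamma\to\mathbb R$ with integral slopes; $\mathrm{slope}_\nu(f)$ is the outgoing slope of $f$ along $\nu$. A divisor $D$ is a finite formal integer combination of points of $\Gamma$, $D(x)$ is its coefficient at $x$, $D\ge 0$ (effective) means all coefficients are $\geq 0$. $\mathrm{div}(f)=\sum_x \mathrm{ord}_x(f)(x)$ with $\mathrm{ord}_x(f)=-\sum_{\nu\in \mathrm T_x(\Gamma)}\mathrm{slope}_\nu(f)$. $\mathrm{Rat}(D)=\{f\in\mathrm{Rat}(\Gamma): D+\mathrm{div}(f)\ge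 0\}$. Hypercube rank functions. Put $[r]=\{0,\dots,r\}$ for an integer $r\ge 0$. The hypercube $[r]^\delta$ ($\delta\geq 1$) carries the coordinatewise order $\preceq$ and coordinatewise max $\vee$ and min $\wedge$; $\underline e_i$ is the $i$-th unit vector. A rank function is a map $\rho\colon[r]^\delta\to\mathbb Z$ such that: (1) $\rho(t\,\underline e_i)=r-t$ for all $i$ and $t\in[r]$; (2) $\underline a\preceq\underline b$ implies $\rho(\underline b)\le\rho(\underline a)$; (3) $\rho(\underline a)+\rho(\underline b)\le\rho(\underline a\vee\underline b)+\rho(\underline a\wedge\underline b)$; (4) $\rho$ takes values in $\{-1,0,\dots,r\}$. A jump of $\rho$ is a point $\underline a$ with $\rho(\underline a)\ge 0$ and $\rho(\underline a+\underline e_i)=\rho(\underline a)-1$ for every $i$ with $\underline a+\underline e_i\in[r]^\delta$. The standard rank function is $\rho(\underline a)=\max\{-1,r-a_1-\dots-a_\delta\}$. Slope structures. A slope structure $\mathfrak S$ of width $r$ on $\Gamma$ is the data, on some simple graph model $G=(V,E)$ of $\Gamma$, of: for every oriented edge $uv$, a set $S^{uv}$ of integers $s_0^{uv}<\dots<s_r^{uv}$ with $s_i^{uv}+s_{r-i}^{vu}=0$; for every $v\in V$, a rank function $\rho_v$ on $[r]^{d_v}$, whose coordinates are indexed by the oriented edges with tail $v$ (equivalently by $\mathrm T_v(\Gamma)$). It is extended to all of $\Gamma$: for $\nu\in \mathrm T_x(\Gamma)$, $S^\nu=\{s_0^\nu<\dots<s_r^\nu\}$ is $S^{uv}$ for the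 oriented edge $uv$ parallel to $\nu$; for $x\in\Gamma\setminus V$, $\rho_x$ is the standard rank function on $[r]^2$. Two slope structures on $\Gamma$ (possibly given on different models) are equal if they have the same width, the same sets $S^\nu$ and the same rank functions $\rho_x$ for all $x\in\Gamma$, $\nu\in\mathrm T_x(\Gamma)$. For $\underline a=(a_\nu)_\nu\in[r]^{\mathrm T_x(\Gamma)}$ put $s_{\underline a}=(s^\nu_{a_\nu})_\nu$, and let $S^x=\{s_{\underline a}:\underline a\text{ a jump of }\rho_x\}$. A function $f\in\mathrm{Rat}(\Gamma)$ is compatible with $\mathfrak S$ if for every $x\in\Gamma$, $\mathrm{slope}_\nu(f)\in S^\nu$ for all $\nu\in\mathrm T_x(\Gamma)$, and $\partial_x(f):=(\mathrm{slope}_\nu(f))_{\nu\in \mathrm T_x(\Gamma)}\in S^x$. If $\partial_x(f)=s_{\underline a}$, write $\rho_x(\partial_x(f)):=\rho_x(\underline a)$. $\mathrm{Rat}(D,\mathfrak S)$ is the set of $f\in\mathrm{Rat}(D)$ compatible with $\mathfrak S$. Admissible semimodules. A semimodule is a subset of $\mathrm{Rat}(\Gamma)$ stable under $(f,g)\mapsto\min(f,g)$ and $f\mapsto f+c$, $c\in\mathbb R$. A semimodule $M\subseteq\mathrm{Rat}(D)$ is admissible of rank $r$, with underlying slope structure $\mathfrak S$, if it is closed for the topology of $\|\cdot\|_\infty$, $\mathfrak S$ is a slope structure of width $r$ with $M\subseteq\mathrm{Rat}(D,\mathfrak S)$, and for every effective divisor $E$ of degree $r$ there is $f\in M$ with $\rho_x(\partial_x(f))\ge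 E(x)$ for all $x\in\Gamma$ and $D+\mathrm{div}(f)-E\ge 0$. It is admissible if it is admissible of rank $r$ with some underlying slope structure, for some $r\geq 0$. *)

(* Defs.v *)
From HB Require Import structures.
From mathcomp Require Import all_boot all_order all_algebra finmap.
From mathcomp Require Import all_classical all_reals all_analysis.
From mathcomp Require Import lra.

Set Implicit Arguments.
Unset Strict Implicit.
Unset Printing Implicit Defensive.

Import Order.TTheory GRing.Theory Num.Theory.
Import numFieldNormedType.Exports.

Local Open Scope classical_set_scope.
Local Open Scope ring_scope.

(* Loops and parallel edges are allowed; the orientation src/tgt of each edge
   is auxiliary. *)
Record metric_graph (R : realType) := MetricGraph {
  vertex : finType;
  edge : finType;
  src : edge -> vertex;
  tgt : edge -> vertex;
  len : edge -> R;
  len_gt0 : forall e, 0 < len e;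
  edge_exists : (0 < #|edge|)%N;
  graph_connected : forall u v, connect
    [rel a b | [exists e, (src e == a) && (tgt e == b)
                       || (src e == b) && (tgt e == a)]] u v
}.

Section Realization.
Context {R : realType}.
Implicit Type G : metric_graph R.

(* The gluing of the intervals [0, len e]: vertices, and the pairs (e, t) with
   t in the interior of [0, len e]. *)
Definition point G : Type :=
  (vertex G + {p : edge G * R | 0 < p.2 < len p.1})%type.

HB.instance Definition _ G := Choice.on (point G).

(* The quotient map [0, len e] -> G; junk outside of [0, len e]. *)
Definition chart G (e : edge G) (t : R) : point G :=
  if insub (e, t) is Some p then inr p
  else if t <= 0 then inl (src e) else inl (tgt e).

(* Lengths of the piecewise linear paths from x. *)
Inductive path_length G (x : point G) : point G -> R -> Prop :=
| PathNil : path_length x x 0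
| PathStep e s t l : 0 <= s <= len e -> 0 <= t <= len e ->
    path_length x (chart e s) l ->
    path_length x (chart e t) (l + `|t - s|).

Definition path_dist G (x y : point G) : R := inf [set l | path_length x y l].

Section PathMetric.
Context G.
Implicit Types (x y z : point G) (e : edge G).

Lemma chart0 e : chart e 0 = inl (src e).
Proof.
rewrite /chart; case: insubP => [u|_]; last by rewrite lexx.
by rewrite /= ltxx.
Qed.

Lemma chart_len e : chart e (len e) = inl (tgt e).
Proof.
rewrite /chart; case: insubP => [u|_]; first by rewrite /= ltxx andbF.
by rewrite leNgt len_gt0.
Qed.

Lemma path_length_ge0 x y l : path_length x y l -> 0 <= l.
Proof. by elim=> // e s t k _ _ _ k0; rewrite addr_ge0. Qed.

Lemma path_length_cat x y z k l :
  path_length x y k -> path_length y z l -> path_length x z (k + l).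
Proof.
move=> xy; elim=> [|e s t m hs ht _ IH]; first by rewrite addr0.
by rewrite addrA; exact: PathStep.
Qed.

Lemma path_length_sym x y l : path_length x y l -> path_length y x l.
Proof.
elim=> [|e s t k hs ht _ IH]; first exact: PathNil.
rewrite addrC; apply: path_length_cat IH.
by rewrite distrC -[X in path_length _ _ X]add0r; apply: PathStep => //; exact: PathNil.
Qed.

Lemma path_length_edge e s t : 0 <= s <= len e -> 0 <= t <= len e ->
  path_length (chart e s) (chart e t) `|t - s|.
Proof.
by move=> hs ht; rewrite -[X in path_length _ _ X]add0r; apply: PathStep => //; exact: PathNil.
Qed.

Lemma path_length_vertex (u v : vertex G) :
  exists l, path_length (inl u : point G) (inl v) l.
Proof.
have /connectP[p + ->] := graph_connected u v.
elim: p u => [|w p IH] u /=; first by move=> _; exists 0; exact: PathNil.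
move=> /andP[/existsP[e eP] /IH[l lP]].
have l0 := len_gt0 e; have h0 : (0 : R) <= 0 <= len e by lra.
have h1 : 0 <= len e <= len e by lra.
have [k kP] : exists k, path_length (inl u : point G) (inl w) k.
  by case/orP: eP => /andP[/eqP <- /eqP <-]; rewrite -chart0 -chart_len;
    eexists; apply: path_length_edge.
by exists (k + l); exact: path_length_cat lP.
Qed.

Lemma path_length_to_vertex x :
  exists (v : vertex G) l, path_length x (inl v) l.
Proof.
case: x => [v|[[e t] /= et]]; first by exists v, 0; exact: PathNil.
exists (src e), `|0 - t|; rewrite -chart0.
have -> : inr (exist _ (e, t) et) = chart e t :> point G.
  by rewrite /chart insubT.
by case/andP: (et) => t0 t1; apply: path_length_edge; rewrite ?lexx ?ltW ?len_gt0.
Qed.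

Lemma path_length_exists x y : exists l, path_length x y l.
Proof.
have [u [k xu]] := path_length_to_vertex x.
have [v [l yv]] := path_length_to_vertex y.
have [m uv] := path_length_vertex u v.
exists (k + (m + l)); apply: path_length_cat xu _; apply: path_length_cat uv _.
exact: path_length_sym.
Qed.

Lemma path_length_has_inf x y : has_inf [set l | path_length x y l].
Proof.
split; first by have [l] := path_length_exists x y; exists l.
by exists 0 => l /path_length_ge0.
Qed.

Lemma path_dist_le x y l : path_length x y l -> path_dist x y <= l.
Proof. by move=> xy; apply: ge_inf => //; case: (path_length_has_inf x y). Qed.

Lemma path_dist_ge x y c :
  (forall l, path_length x y l -> c <= l) -> c <= path_dist x y.
Proof. by move=> h; apply: lb_le_inf => //; case: (path_length_has_inf x y). Qed.

Lemma path_distxx x : path_dist x x = 0.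
Proof.
apply/eqP; rewrite eq_le path_dist_le ?path_dist_ge //; last exact: PathNil.
by move=> l /path_length_ge0.
Qed.

Lemma path_dist_sym x y : path_dist x y = path_dist y x.
Proof.
by rewrite /path_dist; congr inf; apply/seteqP; split=> l /path_length_sym.
Qed.

Lemma path_dist_triangle y x z :
  path_dist x z <= path_dist x y + path_dist y z.
Proof.
rewrite -lerBlDr; apply: path_dist_ge => k xy.
rewrite lerBlDr -lerBlDl; apply: path_dist_ge => l yz.
by rewrite lerBlDl; apply: path_dist_le; exact: path_length_cat yz.
Qed.

Definition glue (gV : vertex G -> R) (g : edge G -> R -> R) (z : point G) : R :=
  match z with inl v => gV v | inr p => g (val p).1 (val p).2 end.

(* A function that is 1-Lipschitz along every edge bounds lengths from below. *)
Lemma path_length_lip gV g x y l :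
  (forall e, g e 0 = gV (src e)) -> (forall e, g e (len e) = gV (tgt e)) ->
  (forall e s t, 0 <= s <= len e -> 0 <= t <= len e ->
     g e s - g e t <= `|t - s|) ->
  path_length x y l -> glue gV g x - glue gV g y <= l.
Proof.
move=> g0 g1 glip xy.
have hE e s : 0 <= s <= len e -> glue gV g (chart e s) = g e s.
  move=> /andP[s0 s1]; rewrite /chart; case: insubP => [u _ /= ->//|/=].
  rewrite negb_and -!leNgt; case: (leP s 0) => /= [s0' _|_ s1'].
    by have -> : s = 0 by lra.
  by have -> : s = len e by lra.
elim: xy => [|e s t k hs ht _ IH]; first by rewrite subrr.
by have := glip e s t hs ht; rewrite (hE _ _ hs) in IH; rewrite (hE _ _ ht); lra.
Qed.

Lemma path_dist_gt0_inner (p : {p : edge G * R | 0 < p.2 < len p.1}) y :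
  inr p != y -> 0 < path_dist (inr p) y.
Proof.
case: p => [[e0 t0] /= pP] py.
have [t00 t01] := andP pP; rewrite /= in t00 t01.
have [r [r_gt0 r_le r_le' ry]] : exists r, [/\ 0 < r, r <= t0, r <= len e0 - t0 &
    if y is inr q then (val q).1 = e0 -> r <= `|(val q).2 - t0| else True].
  pose r0 := Num.min t0 (len e0 - t0).
  have r00 : 0 < r0 by rewrite lt_min t00 subr_gt0.
  have r0le : r0 <= t0 /\ r0 <= len e0 - t0 by rewrite !ge_min !lexx orbT.
  case: y py => [v|[[e t] /= qP]] py; first by exists r0; case: r0le.
  have [ee|ee] := eqVneq e e0; last first.
    by exists r0; case: r0le => ? ?; split=> // /eqP; rewrite (negbTE ee).
  have tt : 0 < `|t - t0|.
    rewrite normr_gt0 subr_eq0; apply: contraNneq py => tt.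
    by apply/eqP; congr inr; apply: val_inj; rewrite /= ee tt.
  exists (Num.min r0 `|t - t0|); rewrite lt_min r00 tt; split=> //;
    by rewrite !ge_min ?lexx ?orbT //; case: r0le => -> ->.
pose g e t := if e == e0 then Num.max 0 (r - `|t - t0|) else 0.
have gx : glue (fun=> 0) g (inr (exist _ (e0, t0) pP)) = r.
  by rewrite /= /g eqxx subrr normr0 subr0; apply/max_idPr/ltW.
have gy : glue (fun=> 0) g y = 0.
  case: y ry {py} => [//|q] ry; rewrite /= /g; case: eqP => // /ry rle.
  by apply/max_idPl; rewrite subr_le0.
apply: (lt_le_trans r_gt0); apply: path_dist_ge => l xy.
suff: glue (fun=> 0) g (inr (exist _ (e0, t0) pP)) - glue (fun=> 0) g y <= l.
  by rewrite gx gy subr0.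
apply: path_length_lip xy => e.
- rewrite /g; case: eqP => // _; apply/max_idPl.
  by rewrite sub0r normrN gtr0_norm //; lra.
- rewrite /g; case: eqP => // ->; apply/max_idPl.
  by rewrite ger0_norm; lra.
- move=> s t _ _; rewrite /g; case: eqP => [_|_]; last by rewrite subrr.
  have := ler_distD s t t0; have := normr_ge0 (t - s).
  by rewrite /Num.max; do 2 case: ifP => [|/negbT]; rewrite -?leNgt; lra.
Qed.

Lemma path_dist_gt0_vertex (u v : vertex G) :
  u != v -> 0 < path_dist (inl u : point G) (inl v).
Proof.
move=> uv; pose r : R := \big[Num.min/1]_(e : edge G) len e.
have r_gt0 : 0 < r.
  rewrite /r; elim/big_ind: _ => [|a b a0 b0|e _]; first exact: ltr01.
  - by rewrite lt_min a0.
  - exact: len_gt0.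
have r_le e : r <= len e by rewrite /r (bigD1 e) //= ge_min lexx.
pose a e t := if src e == u then r - t else 0.
pose b e t := if tgt e == u then r - (len e - t) else 0.
pose g e t := Num.max 0 (Num.max (a e t) (b e t)).
apply: (lt_le_trans r_gt0); apply: path_dist_ge => l xy.
have := @path_length_lip (fun w => if w == u then r else 0) g _ _ _ _ _ _ xy.
rewrite /glue eqxx eq_sym (negbTE uv) subr0; apply => e.
- rewrite /g /a /b; have := r_le e; rewrite subr0.
  by case: eqP => _; case: eqP => _ re; rewrite /Num.max;
    do 2 (case: ifP => [|/negbT]; rewrite -?leNgt); lra.
- rewrite /g /a /b; have := r_le e; rewrite subrr.
  by case: eqP => _; case: eqP => _ re; rewrite /Num.max;
    do 2 (case: ifP => [|/negbT]; rewrite -?leNgt); lra.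
- move=> s t hs ht.
  have [h1 h2] : t - s <= `|t - s| /\ s - t <= `|t - s|.
    by rewrite ler_norm -(opprB t s) ler_normr lexx orbT.
  rewrite lerBlDr /g !ge_max; apply/and3P; split.
  + by rewrite addr_ge0 // le_max lexx.
  + suff: a e s <= `|t - s| + a e t by move/le_trans; apply; rewrite lerD2l !le_max lexx !orbT.
    by rewrite /a; case: eqP => _; lra.
  + suff: b e s <= `|t - s| + b e t by move/le_trans; apply; rewrite lerD2l !le_max lexx !orbT.
    by rewrite /b; case: eqP => _; lra.
Qed.

Lemma path_dist_positivity x y : path_dist x y = 0 -> x = y.
Proof.
move=> xy0; apply/eqP/negPn/negP => xy; suff: 0 < path_dist x y by lra.
case: x y xy {xy0} => [u|p] [v|q] xy; last 2 first.
- exact: path_dist_gt0_inner.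
- exact: path_dist_gt0_inner.
- by apply: path_dist_gt0_vertex; apply: contraNneq xy => ->.
- by rewrite path_dist_sym path_dist_gt0_inner // eq_sym.
Qed.

End PathMetric.

HB.instance Definition _ G := @isMetric.Build R (point G) (@path_dist G)
  (@path_distxx G) (@path_dist_positivity G) (@path_dist_sym G)
  (@path_dist_triangle G).

End Realization.

Coercion point : metric_graph >-> Sortclass.

Section Tangents.
Context {R : realType} (G : metric_graph R).

(* The edge d.1, oriented from src to tgt if d.2 and from tgt to src if not. *)
Definition dart : finType := (edge G * bool)%type.

Definition dart_rev (d : dart) : dart := (d.1, ~~ d.2).

Definition dart_tail (d : dart) : vertex G := if d.2 then src d.1 else tgt d.1.

Definition dart_chart (d : dart) (t : R) : G :=
  chart d.1 (if d.2 then t else len d.1 - t).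

(* The darts leaving x: a loop at x counts twice, and x in the interior of an
   edge has the two orientations of that edge. *)
Definition outgoing (x : G) : {set dart} :=
  match x with
  | inl v => [set d | dart_tail d == v]
  | inr p => [set d | d.1 == (val p).1]
  end.

Definition tangent (x : G) : finType := {d : dart | d \in outgoing x}.

(* The parameter of x on dart_chart nu, for nu outgoing at x. *)
Definition tangent_pos (x : G) (nu : tangent x) : R :=
  match x with
  | inl _ => 0
  | inr p => if (val nu).2 then (val p).2 else len (val nu).1 - (val p).2
  end.

(* The unit speed path issued from x along nu, meaningful for small h >= 0. *)
Definition ray (x : G) (nu : tangent x) (h : R) : G :=
  dart_chart (val nu) (tangent_pos nu + h).

End Tangents.

Section Rational.
Context {R : realType} (G : metric_graph R).
Implicit Types (f g : G -> R) (x : G).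

Definition piecewise_affine_int f : Prop :=
  forall e : edge G, exists B : seq R, forall a b : R,
    0 <= a -> a < b -> b <= len e -> (forall c, c \in B -> ~~ (a < c < b)) ->
    exists m : int, forall t, a <= t <= b ->
      f (chart e t) = f (chart e a) + m%:~R * (t - a).

Definition rational_fun : set (G -> R) :=
  [set f | continuous f /\ piecewise_affine_int f].

(* The slope exists and is unique for f in rational_fun; 0 if there is none. *)
Definition slope f x (nu : tangent x) : int :=
  xget 0 [set m : int | \forall h \near 0^'+, f (ray nu h) = f x + m%:~R * h].

Definition ord f x : int := - \sum_(nu : tangent x) slope f nu.

Definition divisor : Type := {fsfun G -> int with 0}.

Definition deg (D : divisor) : int := \sum_(x <- finsupp D) D x.

Definition effective (D : divisor) : Prop := forall x, 0 <= D x.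

Definition RatD (D : divisor) : set (G -> R) :=
  [set f | rational_fun f /\ forall x, 0 <= D x + ord f x].

End Rational.

Section RankFunction.
Variables (r : nat) (T : finType).

Definition cube : Type := {ffun T -> 'I_r.+1}.

Implicit Types (a b : cube) (rho : cube -> int).

Definition cube_axis (i : T) (t : 'I_r.+1) : cube :=
  [ffun j => if j == i then t else ord0].

Definition cube_le a b : Prop := forall i, (a i <= b i)%N.

Definition cube_join a b : cube := [ffun i => Order.max (a i) (b i)].

Definition cube_meet a b : cube := [ffun i => Order.min (a i) (b i)].

(* a + e_i, meaningful for a i < r. *)
Definition cube_succ a (i : T) : cube :=
  [ffun j => if j == i then inord (a j).+1 else a j].

Definition rank_function rho : Prop :=
  [/\ forall i t, rho (cube_axis i t) = r%:Z - t%:Z,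
      forall a b, cube_le a b -> rho b <= rho a,
      forall a b, rho a + rho b <= rho (cube_join a b) + rho (cube_meet a b)
    & forall a, -1 <= rho a <= r%:Z].

Definition jump rho a : Prop :=
  0 <= rho a /\
  forall i, (a i < r)%N -> rho (cube_succ a i) = rho a - 1.

Definition standard_rank a : int :=
  Num.max (-1) (r%:Z - \sum_(i : T) (a i)%:Z).

End RankFunction.

Record simple_model {R : realType} (G : metric_graph R) := SimpleModel {
  model_graph :> metric_graph R;
  model_iso : model_graph -> G;
  model_iso_bij : bijective model_iso;
  model_isometry : forall x y, mdist (model_iso x) (model_iso y) = mdist x y;
  model_no_loop : forall e : edge model_graph, src e != tgt e;
  model_no_parallel : forall e e' : edge model_graph,
    [set src e; tgt e]%SET = [set src e'; tgt e']%SET -> e = e'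
}.

Section SlopeStructure.
Context {R : realType} (G : metric_graph R).

(* nu at x points in the direction of the oriented edge d of the model. *)
Definition parallel (m : simple_model G) (x : G) (nu : tangent x)
    (d : dart m) : Prop :=
  exists2 p : R, 0 <= p < len d.1 &
    \forall h \near 0^'+, model_iso (dart_chart d (p + h)) = ray nu h.

(* The data on the model is edge_slope together with the restriction of
   rank_at to the images of the vertices; tangent_slope and rank_at record the
   extension of this data to G, which is determined by the last two axioms. *)
Record slope_structure (r : nat) := SlopeStructure {
  ss_model : simple_model G;
  edge_slope : dart ss_model -> 'I_r.+1 -> int;
  tangent_slope : forall x : G, tangent x -> 'I_r.+1 -> int;
  rank_at : forall x : G, cube r (tangent x) -> int;
  edge_slope_lt : forall d (i j : 'I_r.+1),
    (i < j)%N -> edge_slope d i < edge_slope d j;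
  edge_slope_rev : forall d i,
    edge_slope d i + edge_slope (dart_rev d) (rev_ord i) = 0;
  rank_at_vertex : forall v : vertex ss_model,
    rank_function (@rank_at (model_iso (inl v : ss_model)));
  tangent_slopeE : forall (x : G) (nu : tangent x) d,
    parallel nu d -> tangent_slope nu = edge_slope d;
  rank_at_standard : forall x : G,
    (forall v : vertex ss_model, model_iso (inl v : ss_model) <> x) ->
    @rank_at x = @standard_rank r (tangent x)
}.

Definition slope_set r (S : slope_structure r) (x : G) (nu : tangent x) :
  set int := range (tangent_slope S nu).

Definition same_slope_structure r r' (S : slope_structure r)
    (S' : slope_structure r') : Prop :=
  exists eq_r : r = r',
    (forall (x : G) (nu : tangent x), slope_set S nu = slope_set S' nu) /\
    (forall (x : G) (a : cube r (tangent x)),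
       rank_at S a = rank_at S' [ffun nu => cast_ord (congr1 succn eq_r) (a nu)]).

(* The tuple of outgoing slopes of f at x is s_a. *)
Definition slopes_at r (S : slope_structure r) (f : G -> R) (x : G)
    (a : cube r (tangent x)) : Prop :=
  forall nu : tangent x, slope f nu = tangent_slope S nu (a nu).

Definition compatible r (S : slope_structure r) (f : G -> R) : Prop :=
  forall x : G,
    (forall nu : tangent x, slope_set S nu (slope f nu)) /\
    (exists2 a : cube r (tangent x), slopes_at S f a & jump (rank_at S (x := x)) a).

Definition RatDS (D : divisor G) r (S : slope_structure r) : set (G -> R) :=
  RatD D `&` compatible S.

Definition semimodule (M : set (G -> R)) : Prop :=
  [/\ M `<=` @rational_fun R G,
      forall f g, M f -> M g -> M (f \min g)
    & forall f (c : R), M f -> M (fun x => f x + c)].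

(* Closed in rational_fun for the topology of uniform convergence. *)
Definition sup_closed (M : set (G -> R)) : Prop :=
  closure (M : set {uniform G -> R}) `&` @rational_fun R G `<=` M.

Definition admissible (D : divisor G) (M : set (G -> R)) r
    (S : slope_structure r) : Prop :=
  [/\ semimodule M, M `<=` RatD D, sup_closed M, M `<=` RatDS D S
    & forall E : divisor G, effective E -> deg E = r%:Z ->
      exists2 f, M f & forall x : G,
        (exists2 a : cube r (tangent x), slopes_at S f a & E x <= rank_at S a)
        /\ 0 <= D x + ord f x - E x].

End SlopeStructure.

(* Main.v *)
(* Near a point [x], every [f] in [M] is concave along each ray. Requiring [i]
   and [r - i] points of the divisor at two nearby points of one ray forces the
   slope [s_{r - i}] in between, so the slopes of [M] along a ray are exactly
   the slope set; hence the widths and slope sets agree.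

   A rank function is determined by its jumps, since [rho b] is the length of
   the longest chain of jumps above a jump [b]. It remains to see that every
   jump [a] at [x] is the slope vector of some [f] in [M]. Climb from [0] to [a]
   through jumps: from a jump [b < a] with [b nu < a nu] pass to the jump [b']
   closing [b + e_nu], which has rank [rho b - 1] and stays below [a] by
   supermodularity. Suppose that the requirement [(rho b) x + E] forces the
   slopes [s_b] at [x]. Then [(rho b - 1) x + y + E] forces [s_b'] when [y] is
   close to [x] along [nu]: otherwise take counterexamples [f_n] with [y_n]
   tending to [x]. As [M] is closed and slopes are bounded, they have a limit [g]
   in [M] up to constants; the slopes of [g] are at most those of [f_n], and
   strictly smaller along [nu] at [x], because [f_n] bends at [y_n]. So [g] meets
   [(rho b) x + E], its slopes at [x] are [s_b], and those of [f_n] lie above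
   [b + e_nu], which leaves only [b']. *)

Require Import Defs.
From mathcomp Require Import all_boot all_order all_algebra finmap.
From mathcomp Require Import all_classical all_reals all_analysis.
From mathcomp Require Import ring lra zify.

Set Implicit Arguments.
Unset Strict Implicit.
Unset Printing Implicit Defensive.

Import Order.TTheory GRing.Theory Num.Theory.
Import numFieldNormedType.Exports.

Local Open Scope classical_set_scope.
Local Open Scope ring_scope.

(** * Rank functions *)

Section CubeRank.
Variables (r : nat) (T : finType).
Implicit Types (a b c : cube r T) (rho : cube r T -> int).

Lemma cube_le_refl a : cube_le a a. Proof. by move=> i. Qed.

Lemma cube_le_trans b a c : cube_le a b -> cube_le b c -> cube_le a c.
Proof. by move=> ab bc i; exact: leq_trans (ab i) (bc i). Qed.

Lemma cube_le_anti a b : cube_le a b -> cube_le b a -> a = b.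
Proof.
by move=> ab ba; apply/ffunP => i; apply/val_inj/eqP; rewrite eqn_leq ab ba.
Qed.

Lemma cube_succE a i j : (a i < r)%N ->
  cube_succ a i j = (a j + (j == i))%N :> nat.
Proof.
move=> ai; rewrite ffunE; case: eqP => [->|_]; last by rewrite addn0.
by rewrite inordK ?addn1.
Qed.

Lemma cube_joinE a b i : cube_join a b i = maxn (a i) (b i) :> nat.
Proof. 
by rewrite ffunE; case: leP; rewrite ?leEord ?ltEord => ab; symmetry;
  [apply/maxn_idPr | apply/maxn_idPl; exact: ltnW]. Qed.

Lemma cube_meetE a b i : cube_meet a b i = minn (a i) (b i) :> nat.
Proof. 
by rewrite ffunE; case: leP; rewrite ?leEord ?ltEord => ab; symmetry;
  [apply/minn_idPl | apply/minn_idPr; exact: ltnW]. Qed.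

Lemma cube_le_succ a i : (a i < r)%N -> cube_le a (cube_succ a i).
Proof. by move=> ai j; rewrite cube_succE // leq_addr. Qed.

Lemma cube_succ_le a b i : cube_le a b -> (a i < b i)%N ->
  cube_le (cube_succ a i) b.
Proof.
move=> ab abi j; rewrite cube_succE ?(leq_trans abi (leq_ord _)) //.
by case: eqP => [->|_]; rewrite ?addn1 ?addn0.
Qed.

Lemma cube_not_le a b : ~ cube_le a b -> exists i, (b i < a i)%N.
Proof. by move/existsNP => [i /negP]; rewrite -ltnNge; exists i. Qed.

Lemma jump_lt rho b c : rank_function rho -> jump rho b -> cube_le b c ->
  b <> c -> rho c <= rho b - 1.
Proof.
move=> [_ mono _ _] [_ jb] bc neq.
have [|i ci] := @cube_not_le c b; first by move/(cube_le_anti bc).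
rewrite -(jb i) ?(leq_trans ci (leq_ord _)) //.
by apply: mono; exact: cube_succ_le.
Qed.

Lemma cube_join_lel a b : cube_le a (cube_join a b).
Proof. by move=> i; rewrite cube_joinE leq_maxl. Qed.

Lemma cube_join_ler a b : cube_le b (cube_join a b).
Proof. by move=> i; rewrite cube_joinE leq_maxr. Qed.

(** Supermodularity for [c] and the axis point [(c_i + 1) e_i]: their join is [c + e_i], their meet
    is [c_i e_i], and the two ranks on the axis differ by one. *)
Lemma rank_succ_ge rho c i : rank_function rho -> (c i < r)%N ->
  rho c - 1 <= rho (cube_succ c i).
Proof.
move=> [axis mono super _] ci.
have := super (cube_axis i (inord (c i).+1)) c.
rewrite (_ : cube_join _ _ = cube_succ c i); last first.
  apply/ffunP => j; apply/val_inj; rewrite /= cube_joinE cube_succE // ffunE.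
  by case: eqP => [->|_]; rewrite ?inordK ?max0n //=; lia.
rewrite (_ : cube_meet _ _ = cube_axis i (c i)); last first.
  apply/ffunP => j; apply/val_inj; rewrite /= cube_meetE !ffunE.
  by case: eqP => [->|_]; rewrite ?inordK ?min0n //=; lia.
by rewrite !axis inordK //; lia.
Qed.

(** At a point of nonnegative rank that is not a jump, some unit step keeps the rank, since a step
    costs 0 or 1. Such steps can be repeated only finitely often. *)
Lemma jump_above rho c : rank_function rho -> 0 <= rho c ->
  exists2 b, jump rho b & cube_le c b /\ rho b = rho c.
Proof.
move=> rk; have [_ mono _ _] := rk.
have [n] := ubnP (\sum_i (r - c i))%N; elim: n c => // n IH c cn c0.
have [jc|/not_andP[//|/existsNP[i /not_implyP[ci ri]]]] := pselect (jump rho c).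
  by exists c => //; split=> //; exact: cube_le_refl.
have le1 := cube_le_succ ci; have le2 := mono _ _ le1.
have le3 := rank_succ_ge rk ci.
have rE : rho (cube_succ c i) = rho c by lia.
have [||b jb [cb bE]] := IH (cube_succ c i); last 1 first.
- by exists b => //; rewrite bE rE; split=> //; exact: cube_le_trans cb.
- rewrite -ltnS; apply: leq_trans cn; rewrite ltnS.
  rewrite [ltnLHS](bigD1 i) //= [ltnRHS](bigD1 i) //= -addSn leq_add //.
    by rewrite cube_succE // eqxx; lia.
  by apply: leq_sum => j ji; rewrite cube_succE // (negbTE ji) addn0.
- by rewrite rE.
Qed.

(* Supermodularity: closing [c] up to a jump of the same rank does not
   overshoot a jump [a] above [c]. *)
Lemma jump_closure_le rho a b c : rank_function rho -> jump rho a ->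
  cube_le c a -> cube_le c b -> rho b = rho c -> cube_le b a.
Proof.
move=> rk ja ca cb bE; have [_ mono super _] := rk.
have cm : cube_le c (cube_meet a b).
  by move=> i; rewrite cube_meetE leq_min ca cb.
have [E|NE] := pselect (a = cube_join a b).
  by rewrite E; exact: cube_join_ler.
have := jump_lt rk ja (@cube_join_lel a b) NE.
by have := super a b; have := mono _ _ cm; lia.
Qed.

Lemma jump_closure_uniq rho a b c : rank_function rho ->
  jump rho a -> jump rho b -> cube_le c a -> cube_le c b ->
  rho a = rho c -> rho b = rho c -> a = b.
Proof.
move=> rk ja jb ca cb aE bE.
by apply: cube_le_anti; apply: (jump_closure_le rk) (jb) _ _ _ ||
  apply: (jump_closure_le rk) (ja) _ _ _; eauto.
Qed.

Lemma rank_axis_le rho b i : rank_function rho -> rho b <= r%:Z - (b i)%:Z.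
Proof.
move=> [axis mono _ _]; rewrite -(axis i); apply: mono => j.
by rewrite ffunE; case: eqP => [->|].
Qed.

(** A chain of [k] links through jumps of [rho] starts at [b]: each link moves one unit along [i0]
    and closes up to a jump. These are also jumps of [rho'], where every strict link costs at least
    one. *)
Lemma rank_ge_jump_le rho rho' b (i0 : T) (k : nat) :
  rank_function rho -> rank_function rho' ->
  (forall a, jump rho a -> jump rho' a) ->
  jump rho b -> k%:Z <= rho b -> k%:Z <= rho' b.
Proof.
move=> rk rk' jj; have [_ mono _ _] := rk.
elim: k b => [|k IH] b jb kb; first by case: (jj _ jb).
have bi : (b i0 < r)%N by have := rank_axis_le b i0 rk; lia.
have rE : rho (cube_succ b i0) = rho b - 1 by case: jb => _; exact.
have [|c jc [bc cE]] := @jump_above rho (cube_succ b i0) rk; first lia.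
have neq : b <> c.
  move=> E; have := bc i0; rewrite cube_succE // eqxx -E; lia.
have := jump_lt rk' (jj _ jb) (cube_le_trans (cube_le_succ bi) bc) neq.
have : k%:Z <= rho' c by apply: IH => //; lia.
lia.
Qed.

(** Closing [c] up to a jump keeps its rank under [rho], and monotonicity of [rho'] brings the bound
    back down to [c]. *)
Lemma rank_le_of_jumps rho rho' (i0 : T) c :
  rank_function rho -> rank_function rho' ->
  (forall a, jump rho a -> jump rho' a) -> rho c <= rho' c.
Proof.
move=> rk rk' jj; have [_ _ _ bd] := rk; have [_ mono' _ bd'] := rk'.
have [c0|c0] := leP 0 (rho c); last by have := bd' c; lia.
have [b jb [cb bE]] := jump_above rk c0.
have [k kE] : exists k : nat, rho b = k by exists `|rho b|%N; lia.
have := rank_ge_jump_le (k := k) i0 rk rk' jj jb; have := mono' _ _ cb; lia.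
Qed.

Lemma rank_eq_of_jumps rho rho' (i0 : T) :
  rank_function rho -> rank_function rho' ->
  (forall a, jump rho a <-> jump rho' a) -> rho =1 rho'.
Proof.
move=> rk rk' jj c; apply/eqP; rewrite eq_le.
by rewrite !(rank_le_of_jumps i0) // => a /jj.
Qed.

Lemma standard_rank_function : rank_function (@standard_rank r T).
Proof.
split.
- move=> i t; rewrite /standard_rank (bigD1 i) //= big1 => [|j /negbTE ji].
    by rewrite ffunE eqxx addr0; have := ltn_ord t; lia.
  by rewrite ffunE ji.
- move=> a b ab; rewrite /standard_rank.
  have : \sum_i (a i)%:Z <= \sum_i (b i)%:Z.
    by apply: ler_sum => i _; have := ab i; lia.
  lia.
- move=> a b; rewrite /standard_rank.
  (* Coordinate sums are modular; truncation at -1 respects supermodularity because it is convex and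
     the sum at the join is the largest. *)
  have E : \sum_i (a i)%:Z + \sum_i (b i)%:Z =
    \sum_i (cube_join a b i)%:Z + \sum_i (cube_meet a b i)%:Z.
    rewrite -!big_split; apply: eq_bigr => i _ /=.
    by rewrite cube_joinE cube_meetE; lia.
  have : \sum_i (a i)%:Z <= \sum_i (cube_join a b i)%:Z.
    by apply: ler_sum => i _; rewrite cube_joinE; lia.
  have : \sum_i (b i)%:Z <= \sum_i (cube_join a b i)%:Z.
    by apply: ler_sum => i _; rewrite cube_joinE; lia.
  lia.
- move=> a; rewrite /standard_rank.
  have : 0 <= \sum_i (a i)%:Z by apply: sumr_ge0 => i _; lia.
  lia.
Qed.

Lemma jump0 rho (i0 : T) : rank_function rho ->
  jump rho [ffun=> ord0] /\ rho [ffun=> ord0] = r.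
Proof.
move=> rk; have [axis _ _ _] := rk.
have E i : [ffun=> ord0] = cube_axis i ord0 :> cube r T.
  by apply/ffunP => j; rewrite !ffunE; case: ifP.
have r0 : rho [ffun=> ord0] = r by rewrite (E i0) axis /=; lia.
split=> //; split=> [|i]; first by rewrite r0.
move=> ir; rewrite r0 (_ : cube_succ _ _ = cube_axis i (inord 1)); last first.
  by apply/ffunP => j; rewrite !ffunE; case: eqP.
by rewrite axis inordK //; move: ir; rewrite ffunE /=; lia.
Qed.

Lemma rank_max_eq0 rho b : rank_function rho -> r%:Z <= rho b ->
  b = [ffun=> ord0].
Proof.
move=> rk rb; apply/ffunP => i; apply/val_inj; rewrite ffunE /=.
by have := rank_axis_le b i rk; lia.
Qed.

End CubeRank.

(** * Darts and tents *)

Lemma near0P (R : realType) (P : R -> Prop) :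
  (\forall h \near 0^'+, P h) <->
  exists2 e : R, 0 < e & forall h, 0 < h < e -> P h.
Proof.
split.
  move=> /nbhs_ballP[e /= e0 eP]; exists e => // h /andP[h0 he].
  by apply: eP => //=; rewrite /ball /= sub0r normrN gtr0_norm.
move=> [e e0 eP]; apply/nbhs_ballP; exists e => //= h /=.
by rewrite /ball /= sub0r normrN => he h0; apply: eP; rewrite h0 -(gtr0_norm h0).
Qed.

Section Geometry.
Context {R : realType}.
Implicit Types G : metric_graph R.

Lemma chart_inner G (e : edge G) (t : R) (et : 0 < t < len e) :
  chart e t = inr (exist _ (e, t) et).
Proof. by rewrite /chart insubT. Qed.

Section Darts.
Context {G : metric_graph R}.
Implicit Types (x y z : G) (d : dart G) (e : edge G) (s t : R).

Definition dart_coord d s : R := if d.2 then s else len d.1 - s.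

Lemma dart_coordK d : involutive (dart_coord d).
Proof. by move=> s; case: d => e []; rewrite /dart_coord //=; lra. Qed.

Lemma dart_revK : involutive (@dart_rev R G).
Proof. by case=> e b; rewrite /dart_rev /= negbK. Qed.

Lemma dart_rev_neq d : dart_rev d != d.
Proof. by case: d => e []; rewrite xpair_eqE eqxx. Qed.

Lemma same_edge_darts d d' : d'.1 = d.1 -> d' = d \/ d' = dart_rev d.
Proof. by case: d => e []; case: d' => e' [] /= ->; by [left | right]. Qed.

Lemma dart_coord_itv d s : (0 <= dart_coord d s <= len d.1) = (0 <= s <= len d.1).
Proof. by rewrite /dart_coord; case: ifP => // _; apply/idP/idP; lra. Qed.

Lemma dart_coord_oitv d s : (0 < dart_coord d s < len d.1) = (0 < s < len d.1).
Proof. by rewrite /dart_coord; case: ifP => // _; apply/idP/idP; lra. Qed.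

Lemma dart_coordB d s t : `|dart_coord d s - dart_coord d t| = `|s - t|.
Proof.
rewrite /dart_coord; case: ifP => // _; rewrite distrC; congr `|_|; lra.
Qed.

Lemma dart_chart_rev d s :
  dart_chart (dart_rev d) s = dart_chart d (len d.1 - s).
Proof.
by case: d => e []; rewrite /dart_chart /=; congr chart; lra.
Qed.

Lemma dart_chart0 d : dart_chart d 0 = inl (dart_tail d).
Proof.
by case: d => e []; rewrite /dart_chart /dart_tail /= ?subr0 (chart0, chart_len).
Qed.

Lemma dart_chart_inner d s : 0 < s < len d.1 ->
  exists H, dart_chart d s = inr (exist _ (d.1, dart_coord d s) H).
Proof.
move=> ds; have ds' : 0 < dart_coord d s < len d.1 by rewrite dart_coord_oitv.
by exists ds'; rewrite /dart_chart -/(dart_coord d s) chart_inner.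
Qed.

(** The end [len d.1] is left out because on a loop it is the same point as 0. *)
Lemma dart_chart_inj d s t : 0 <= s < len d.1 -> 0 <= t < len d.1 ->
  dart_chart d s = dart_chart d t -> s = t.
Proof.
have aux u : 0 < u < len d.1 -> dart_chart d 0 <> dart_chart d u.
  by move=> /dart_chart_inner[H ->]; rewrite dart_chart0.
move=> /andP[]; rewrite le_eqVlt => /predU1P[<-|s0] s1 /andP[];
  rewrite le_eqVlt => /predU1P[<-|t0] t1 // E.
- by case: (@aux t); rewrite ?t0.
- by case: (@aux s); rewrite ?s0.
- have [|H] := @dart_chart_inner d s; first by rewrite s0.
  have [|H'] := @dart_chart_inner d t; first by rewrite t0.
  rewrite E => -> [] E'; rewrite -(dart_coordK d s) -(dart_coordK d t).
  by rewrite E'.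
Qed.

(** [tangent_pos] as a function of a bare dart, free of the proof that the dart is outgoing. *)
Definition dart_pos x d : R :=
  match x with
  | inl _ => 0
  | inr p => dart_coord d (val p).2
  end.

Lemma tangent_posE x (nu : tangent x) : tangent_pos nu = dart_pos x (val nu).
Proof. by case: x nu. Qed.

Lemma dart_pos_itv x d : d \in outgoing x -> 0 <= dart_pos x d < len d.1.
Proof.
case: x => [v|[[e t] /= et]]; first by rewrite lexx len_gt0.
rewrite inE /= => /eqP de; have := dart_coord_oitv d t.
by rewrite de et => /andP[/ltW -> ->].
Qed.

Lemma dart_chart_pos x d : d \in outgoing x -> dart_chart d (dart_pos x d) = x.
Proof.
case: x => [v|[[e t] /= et]]; rewrite inE /=.
  by rewrite dart_chart0 => /eqP ->.
move=> /eqP de; rewrite /dart_chart -/(dart_coord _ _) dart_coordK de.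
exact: chart_inner.
Qed.

Lemma rayE x (nu : tangent x) h :
  ray nu h = dart_chart (val nu) (dart_pos x (val nu) + h).
Proof. by rewrite /ray tangent_posE. Qed.

Lemma outgoing_inner d s d' : 0 < s < len d.1 ->
  (d' \in outgoing (dart_chart d s)) = (d'.1 == d.1).
Proof. by move=> /dart_chart_inner[H ->]; rewrite inE. Qed.

Lemma dart_pos_inner d s : 0 < s < len d.1 -> dart_pos (dart_chart d s) d = s.
Proof. by move=> /dart_chart_inner[H ->] /=; rewrite dart_coordK. Qed.

Lemma dart_pos_inner_rev d s : 0 < s < len d.1 ->
  dart_pos (dart_chart d s) (dart_rev d) = len d.1 - s.
Proof.
move=> /dart_chart_inner[H ->] /=; rewrite /dart_coord /=.
by case: (d.2) => /=; lra.
Qed.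

Lemma path_dist_chart e s t : 0 <= s <= len e -> 0 <= t <= len e ->
  path_dist (chart e s) (chart e t) <= `|t - s|.
Proof. by move=> hs ht; apply: path_dist_le; exact: path_length_edge. Qed.

Lemma path_dist_dart d s t : 0 <= s <= len d.1 -> 0 <= t <= len d.1 ->
  path_dist (dart_chart d s) (dart_chart d t) <= `|t - s|.
Proof.
move=> hs ht; rewrite -(dart_coordB d t s).
by apply: path_dist_chart; rewrite dart_coord_itv.
Qed.

(** A bump about the point at parameter [c], used as a 1-Lipschitz test function to bound distances
    from below. *)
Definition tent d (c r : R) (z : G) : R :=
  if z is inr p then
    if (val p).1 == d.1 then Num.max 0 (r - `|dart_coord d (val p).2 - c|) else 0
  else 0.

(** The condition on [c] makes the bump vanish at both ends of its edge, so its extension by zero is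
    1-Lipschitz along every edge. *)
Lemma tent_lip d c r x y : r <= c <= len d.1 - r ->
  tent d c r x - tent d c r y <= path_dist x y.
Proof.
move=> rc.
have [r0|r0] := leP r 0.
  have E z : tent d c r z = 0.
    rewrite /tent; case: z => // p; case: ifP => // _.
    by apply/max_idPl; have := normr_ge0 (dart_coord d (val p).2 - c); lra.
  by rewrite !E subrr; apply: path_dist_ge => l /path_length_ge0.
pose g e t := if e == d.1 then Num.max 0 (r - `|dart_coord d t - c|) else 0.
apply: path_dist_ge => l xy.
have : Defs.glue (fun=> 0) g x - Defs.glue (fun=> 0) g y <= l.
  apply: path_length_lip xy => e.
  - rewrite /g; case: eqP => // _; apply/max_idPl.
    rewrite /dart_coord; case: ifP => _.
      by rewrite sub0r normrN gtr0_norm; lra.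
    by rewrite subr0 gtr0_norm; lra.
  - rewrite /g; case: eqP => // ->; apply/max_idPl.
    rewrite /dart_coord; case: ifP => _.
      by rewrite gtr0_norm; lra.
    by rewrite subrr sub0r normrN gtr0_norm; lra.
  - move=> s t _ _; rewrite /g; case: eqP => [_|_]; last by rewrite subrr.
    have := ler_distD (dart_coord d s) (dart_coord d t) c.
    have := normr_ge0 (t - s); rewrite dart_coordB /Num.max.
    by do 2 case: ifP => [|/negbT]; rewrite -?leNgt; lra.
by rewrite /Defs.glue /g /tent; case: x {xy} => [?|?]; case: y => [?|?].
Qed.

Lemma tent_dart d c r s : r <= c <= len d.1 - r -> 0 <= s <= len d.1 ->
  tent d c r (dart_chart d s) = Num.max 0 (r - `|s - c|).
Proof.
move=> rc sd; have [sd'|sd'] := boolP (0 < s < len d.1).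
  have [H ->] := dart_chart_inner sd'.
  by rewrite /tent /= eqxx dart_coordK.
have [sE|sE] : s = 0 \/ s = len d.1 by lra.
  rewrite sE dart_chart0 /=; apply/esym/max_idPl.
  by have := ler_norm (c - 0); rewrite distrC; lra.
rewrite sE -[X in dart_chart d X]subr0 -dart_chart_rev dart_chart0 /=.
by apply/esym/max_idPl; have := ler_norm (len d.1 - c); lra.
Qed.

Lemma tent_other d c r (d' : dart G) s : d'.1 != d.1 ->
  tent d c r (dart_chart d' s) = 0.
Proof.
move=> dd; rewrite /dart_chart /chart; case: insubP => [u _ uE|_]; last by case: ifP.
by rewrite /tent uE /= (negbTE dd).
Qed.

End Darts.
End Geometry.

(** * Star-shaped neighbourhoods of a point *)

Section Star.
Context {R : realType}.

Lemma finite_pos_lb (I : finType) (F : I -> R) :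
  (forall i, 0 < F i) -> exists2 e : R, 0 < e & forall i, e <= F i.
Proof.
move=> F0; exists (\big[Num.min/1]_i F i).
  elim/big_ind: _ => [|a b a0 b0|i _]; first exact: ltr01.
    by rewrite lt_min a0.
  exact: F0.
by move=> i; rewrite (bigD1 i) //= ge_min lexx.
Qed.

Section StarLemmas.
Context {G : metric_graph R}.
Implicit Types (x y z : G) (d : dart G) (e : edge G) (s t : R).

(** The factor 4 keeps initial segments of length [eps] apart even at the two ends of a loop, and
    leaves room for tents of radius [2 * eps]. *)
Definition star_radius x (eps : R) :=
  0 < eps /\ forall d, d \in outgoing x -> dart_pos x d + 4 * eps <= len d.1.

Lemma star_radius_exists x : exists eps, star_radius x eps.
Proof.
have [|e e0 eP] := @finite_pos_lb (tangent x)
    (fun nu => (len (val nu).1 - dart_pos x (val nu)) / 4).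
  by move=> nu; have /andP[_ ?] := dart_pos_itv (valP nu); rewrite divr_gt0 //; lra.
exists e; split=> // d dx; have := eP (exist _ d dx); rewrite /=; lra.
Qed.

Lemma star_radius_le x eps eps' : star_radius x eps ->
  0 < eps' <= eps -> star_radius x eps'.
Proof.
by move=> [e0 eP] /andP[e'0 ee']; split=> // d /eP; lra.
Qed.

(** The segment itself gives the upper bound. The lower bound comes from the tent peaking at
    distance [eps] from [x], which is 0 at [x] and [t] at the far point. *)
Lemma star_ray_dist x eps d t : star_radius x eps -> d \in outgoing x ->
  0 <= t <= eps -> path_dist x (dart_chart d (dart_pos x d + t)) = t.
Proof.
move=> [e0 eP] dx te; have de := eP _ dx; have /andP[p0 pl] := dart_pos_itv dx.
apply/eqP; rewrite eq_le -{1}(dart_chart_pos dx); apply/andP; split.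
  apply: le_trans (path_dist_dart _ _) _; try lra.
  by rewrite (_ : _ - _ = t) ?ger0_norm; lra.
rewrite path_dist_sym.
apply: le_trans (@tent_lip _ _ d (dart_pos x d + eps) eps _ _ _); last lra.
rewrite -{4}(dart_chart_pos dx) !tent_dart; try lra.
rewrite (_ : _ - (dart_pos x d + eps) = t - eps); last lra.
rewrite (_ : _ - (dart_pos x d + eps) = - eps); last lra.
rewrite normrN (ler0_norm (x := t - eps)) ?(gtr0_norm e0); try lra.
by rewrite /Num.max; do 2 case: ifP => [|/negbT]; rewrite -?leNgt; lra.
Qed.

Lemma star_ray_dist_other x eps d d' t t' : star_radius x eps ->
  d \in outgoing x -> d' \in outgoing x -> d != d' ->
  0 <= t <= eps -> 0 <= t' <= eps ->
  t <= path_dist (dart_chart d (dart_pos x d + t))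
                 (dart_chart d' (dart_pos x d' + t')).
Proof.
move=> [e0 eP] dx d'x dd' te t'e.
have de := eP _ dx; have /andP[p0 pl] := dart_pos_itv dx.
apply: le_trans (@tent_lip _ _ d (dart_pos x d + eps) eps _ _ _); last lra.
have -> : tent d (dart_pos x d + eps) eps
    (dart_chart d' (dart_pos x d' + t')) = 0.
  (* Distinct outgoing darts can share an edge, at a loop or at an interior point; they are then
     reverses of each other, and the second segment lies outside the tent. *)
  have [dd1|] := eqVneq d'.1 d.1; last exact: tent_other.
  have [E|E] := same_edge_darts dd1; first by rewrite E eqxx in dd'.
  rewrite E dart_chart_rev tent_dart; try lra; last first.
    have := eP _ d'x; have /andP[] := dart_pos_itv d'x; rewrite E /=; lra.
  apply/max_idPl; case: x dx d'x {dd' eP} de p0 pl => [v|p] /=.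
    by move=> _ _ *; have := ler_norm (len d.1 - (0 + t') - (0 + eps)); lra.
  rewrite !inE => /eqP dp _ _ _ _; rewrite -normrN.
  set q := (val p).2.
  have := ler_norm (- (len d.1 - (dart_coord (dart_rev d) q + t') - (dart_coord d q + eps))).
  by rewrite /dart_coord /=; case: (d.2) => /=; lra.
rewrite tent_dart; try lra.
rewrite (_ : _ - (dart_pos x d + eps) = t - eps); last lra.
rewrite (ler0_norm (x := t - eps)); last lra.
by rewrite /Num.max; case: ifP => [|/negbT]; rewrite -?leNgt; lra.
Qed.

(** A 1-Lipschitz function peaking at [x] and supported near it is still large at [z], which places
    [z] on one of the outgoing segments. *)
Lemma star_cover x eps z : star_radius x eps -> 0 < path_dist x z < eps ->
  exists2 d, d \in outgoing x & z = dart_chart d (dart_pos x d + path_dist x z).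
Proof.
move=> xe; have [e0 eP] := xe => /andP[xz0 xze].
suff [d dx [u ue zE]] : exists2 d, d \in outgoing x &
    exists2 u, 0 <= u <= eps & z = dart_chart d (dart_pos x d + u).
  by exists d => //; rewrite {2}zE (star_ray_dist xe).
case: x {xe} eP xz0 xze => [v|[[e t] /= et]] eP xz0 xze.
- have lene e : (src e == v) || (tgt e == v) -> 4 * eps <= len e.
    case/orP => ev; first by have := eP (e, true); rewrite inE /= ev add0r; apply.
    by have := eP (e, false); rewrite inE /= ev add0r; apply.
  (* [a] and [b] treat the two ends of an edge separately, so that a loop at [v] gets a bump at
     both. *)
  pose a e t := if src e == v then eps - t else 0.
  pose b e t := if tgt e == v then eps - (len e - t) else 0.
  pose g e t := Num.max 0 (Num.max (a e t) (b e t)).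
  pose gV w := if w == v then eps else 0.
  have : Defs.glue gV g (inl v) - Defs.glue gV g z <= path_dist (inl v) z.
    apply: path_dist_ge => l; apply: path_length_lip => e.
    + have := lene e; rewrite /g /gV /a /b.
      by do 2 (case: eqP => _ /=); move=> le; try move: (le isT);
        rewrite /Num.max; do 2 (case: ifP => [|/negbT]; rewrite -?leNgt); lra.
    + have := lene e; rewrite /g /gV /a /b.
      by do 2 (case: eqP => _ /=); move=> le; try move: (le isT);
        rewrite /Num.max; do 2 (case: ifP => [|/negbT]; rewrite -?leNgt); lra.
    + move=> s t hs ht.
      have [h1 h2] : t - s <= `|t - s| /\ s - t <= `|t - s|.
        by rewrite ler_norm -(opprB t s) ler_normr lexx orbT.
      rewrite lerBlDr /g !ge_max; apply/and3P; split.
      * by rewrite addr_ge0 // le_max lexx.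
      * suff: a e s <= `|t - s| + a e t
          by move/le_trans; apply; rewrite lerD2l !le_max lexx !orbT.
        by rewrite /a; case: eqP => _; lra.
      * suff: b e s <= `|t - s| + b e t
          by move/le_trans; apply; rewrite lerD2l !le_max lexx !orbT.
        by rewrite /b; case: eqP => _; lra.
  rewrite {1}/Defs.glue {1}/gV eqxx => zl.
  have gz0 : 0 < Defs.glue gV g z by lra.
  case: z xz0 xze gz0 {zl} => [w|[[e t] /= et]].
    rewrite /= /gV; case: eqP => [->|_]; last by rewrite ltxx.
    by rewrite path_distxx ltxx.
  move=> _ _; rewrite /= /g !lt_max ltxx /= /a /b.
  have zE : inr (exist _ (e, t) et) = chart e t :> G by rewrite chart_inner.
  case/orP; case: eqP => ev; rewrite ?ltxx // => te.
    exists (e, true); first by rewrite inE /= /dart_tail /= ev.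
    by exists t; [lra | rewrite add0r zE].
  exists (e, false); first by rewrite inE /= /dart_tail /= ev.
  exists (len e - t); first lra.
  by rewrite /= add0r zE /dart_chart /=; congr chart; lra.
- set x : G := inr _ in eP xz0 xze *.
  have h1 : t + 4 * eps <= len e by have := eP (e, true); rewrite inE /= eqxx; apply.
  have h2 : (len e - t) + 4 * eps <= len e.
    by have := eP (e, false); rewrite inE /= eqxx; apply.
  (* With radius [2 * eps], a value above [eps] at [z] puts it within [eps] of [x]. *)
  have := @tent_lip _ _ (e, true) t (2 * eps) x z.
  rewrite {1}/tent /= eqxx /dart_coord /= subrr normr0 subr0.
  rewrite (_ : Num.max 0 _ = 2 * eps); last by apply/max_idPr; lra.
  move=> zl; have : eps < tent (e, true) t (2 * eps) z by have := zl ltac:(lra); lra.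
  case: z xz0 xze {zl} => [w _ _|[[e' t'] /= e't'] _ _]; rewrite /tent /=.
    by move=> *; lra.
  case: eqP => [ee|_]; last by move=> *; lra.
  rewrite lt_max /dart_coord /= => /orP[|tt]; first by move=> *; lra.
  have tt1 := ler_norm (t' - t); have := ler_norm (- (t' - t)); rewrite normrN => tt2.
  have zE : inr (exist _ (e', t') e't') = chart e t' :> G.
    by rewrite -ee chart_inner.
  have [t't|t't] := leP t t'.
    exists (e, true); first by rewrite inE.
    exists (t' - t); first lra.
    by rewrite zE /dart_chart /dart_coord /=; congr chart; lra.
  exists (e, false); first by rewrite inE.
  exists (t - t'); first lra.
  by rewrite zE /dart_chart /dart_coord /=; congr chart; lra.
Qed.

End StarLemmas.

End Star.

(** * Simple models and tangents *)

Section Parallel.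
Context {R : realType}.

(* Points at distance [h] from the preimage of [x] lie on a ray; the ray does
   not depend on [h], since points on different rays at distances [h] and [h0]
   are at distance at least [max h h0 > |h - h0|]. *)
Lemma parallel_exists (G : metric_graph R) (m : simple_model G) (x : G)
    (nu : tangent x) : exists d : dart m, parallel nu d.
Proof.
have [psi psiK iK] := model_iso_bij m.
set y := psi x.
have [e1 xe1] := star_radius_exists x; have [e2 ye2] := star_radius_exists y.
have [e10 _] := xe1; have [e20 _] := ye2.
pose e := Num.min e1 e2.
have e0 : 0 < e by rewrite lt_min e10.
have xe : star_radius x e by apply: star_radius_le xe1 _; rewrite e0 ge_min lexx.
have ye : star_radius y e by apply: star_radius_le ye2 _; rewrite e0 ge_min lexx orbT.
have zdist (h : R) : 0 < h < e -> path_dist y (psi (ray nu h)) = h.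
  move=> he; have <- : path_dist x (ray nu h) = path_dist y (psi (ray nu h)).
    by rewrite -{1}(iK x) -{1}(iK (ray nu h)); exact: model_isometry.
  by rewrite rayE; apply: star_ray_dist xe (valP nu) _; lra.
have cover (h : R) : 0 < h < e -> exists2 d, d \in outgoing y &
    psi (ray nu h) = dart_chart d (dart_pos y d + h).
  move=> he; have [|d dy E] := star_cover (z := psi (ray nu h)) ye.
    by rewrite zdist.
  by exists d => //; rewrite {1}E zdist.
have [|d dy dE] := cover (e / 2); first lra.
exists d, (dart_pos y d); first exact: dart_pos_itv.
apply/near0P; exists e => // h he.
suff <- : psi (ray nu h) = dart_chart d (dart_pos y d + h) by rewrite iK.
have [d' d'y d'E] := cover h he.
have [<-//|dd'] := eqVneq d' d.
have hl : path_dist (psi (ray nu h)) (psi (ray nu (e / 2))) <= `|e / 2 - h|.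
  have <- : path_dist (ray nu h) (ray nu (e / 2)) =
      path_dist (psi (ray nu h)) (psi (ray nu (e / 2))).
    by rewrite -{1}(iK (ray nu h)) -{1}(iK (ray nu (e / 2))); exact: model_isometry.
  rewrite !rayE.
  have [_ /(_ _ (valP nu)) le] := xe; have /andP[? ?] := dart_pos_itv (valP nu).
  apply: le_trans (path_dist_dart _ _) _; try lra.
  by rewrite opprD addrACA subrr add0r.
have h1 : h <= path_dist (psi (ray nu h)) (psi (ray nu (e / 2))).
  by rewrite d'E dE; apply: star_ray_dist_other ye _ _ _ _ _ => //; lra.
have h2 : e / 2 <= path_dist (psi (ray nu h)) (psi (ray nu (e / 2))).
  rewrite path_dist_sym d'E dE; apply: star_ray_dist_other ye _ _ _ _ _ => //.
  - by rewrite eq_sym.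
  - by lra.
  - by lra.
exfalso; have [hh|hh] := leP h (e / 2).
  by rewrite ger0_norm in hl; lra.
by rewrite ltr0_norm in hl; lra.
Qed.

End Parallel.

Section LocalStructure.
Context {R : realType} (G : metric_graph R).
Implicit Types (x y : G) (d : dart G).

(** An isolated vertex is excluded by connectedness and the existence of an edge. *)
Lemma exists_tangent x : exists nu : tangent x, true.
Proof.
suff [d dx] : exists d, d \in outgoing x by exists (Sub d dx).
case: x => [v|[[e t] /= et]]; last by exists (e, true); rewrite inE /=.
have /card_gt0P[e0 _] := edge_exists G.
have /connectP[[|w p] /=] := graph_connected v (src e0).
  by move=> _ E; exists (e0, true); rewrite inE /dart_tail /= E.
move=> /andP[/existsP[e /orP[/andP[ev _]|/andP[_ ev]]] _] _.
  by exists (e, true); rewrite inE.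
by exists (e, false); rewrite inE.
Qed.

Lemma sum_inner (V : nmodType) d s (nu mu : tangent (dart_chart d s))
    (F : tangent (dart_chart d s) -> V) :
  0 < s < len d.1 -> val nu = d -> val mu = dart_rev d ->
  \sum_i F i = F nu + F mu.
Proof.
move=> ds nud mud; rewrite (bigD1 nu) //= (bigD1 mu) /=; last first.
  by rewrite -val_eqE /= nud mud dart_rev_neq.
rewrite big1 ?addr0 // => i /andP[inu imu]; exfalso.
have := valP i; rewrite outgoing_inner // => /eqP /same_edge_darts[E|E].
  by rewrite -val_eqE /= E nud eqxx in inu.
by rewrite -val_eqE /= E mud eqxx in imu.
Qed.

Lemma inner_tangents d s : 0 < s < len d.1 ->
  (exists nu : tangent (dart_chart d s), val nu = d) /\
  (exists mu : tangent (dart_chart d s), val mu = dart_rev d).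
Proof.
move=> ds; have h1 : d \in outgoing (dart_chart d s) by rewrite outgoing_inner.
have h2 : dart_rev d \in outgoing (dart_chart d s) by rewrite outgoing_inner.
by split; [exists (Sub d h1) | exists (Sub (dart_rev d) h2)]; rewrite SubK.
Qed.

Lemma ray_avoids x (nu : tangent x) (P : seq G) :
  exists2 eps : R, 0 < eps & forall h, 0 < h < eps ->
    dart_chart (val nu) (dart_pos x (val nu) + h) \notin P.
Proof.
have /andP[p0 pl] := dart_pos_itv (valP nu).
set d := val nu in p0 pl *; set p := dart_pos x d in p0 pl *.
elim: P => [|q P [e e0 eP]]; first by exists 1.
have [[h0 /andP[h00 h0l] E]|NE] :=
  pselect (exists2 h0, 0 < h0 < len d.1 - p & q = dart_chart d (p + h0)).
  exists (Num.min e h0) => [|h]; first by rewrite lt_min e0.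
  rewrite lt_min => /and3P[h1 h2 h3]; rewrite inE negb_or eP ?h1 // andbT E.
  by apply/eqP => /dart_chart_inj hE; have := hE ltac:(lra) ltac:(lra); lra.
exists (Num.min e (len d.1 - p)) => [|h]; first by rewrite lt_min e0 subr_gt0.
rewrite lt_min => /and3P[h1 h2 h3]; rewrite inE negb_or eP ?h1 // andbT.
by apply/eqP => E; apply: NE; exists h; rewrite ?h1 ?E.
Qed.

Section SlopeStructures.
Variables (r : nat) (S : slope_structure G r).

Lemma tangent_slope_edge x (nu : tangent x) :
  exists d : dart (ss_model S), tangent_slope S nu = edge_slope d.
Proof.
by have [d nud] := parallel_exists (ss_model S) nu; exists d; exact: tangent_slopeE.
Qed.

Lemma tangent_slope_lt x (nu : tangent x) (i j : 'I_r.+1) :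
  (tangent_slope S nu i < tangent_slope S nu j) = (i < j)%N.
Proof.
have [d ->] := tangent_slope_edge nu.
case: (ltngtP i j) => [/edge_slope_lt->//|ji|/val_inj->]; last by rewrite ltxx.
by apply/negbTE; rewrite -leNgt ltW // edge_slope_lt.
Qed.

Lemma tangent_slope_le x (nu : tangent x) (i j : 'I_r.+1) :
  (tangent_slope S nu i <= tangent_slope S nu j) = (i <= j)%N.
Proof. by rewrite leNgt tangent_slope_lt -leqNgt. Qed.

Lemma tangent_slope_inj x (nu : tangent x) : injective (tangent_slope S nu).
Proof.
move=> i j E; apply/val_inj/eqP.
by rewrite eqn_leq -!(tangent_slope_le nu) E lexx.
Qed.

Lemma tangent_slope_bounded : exists K : nat,
  forall x (nu : tangent x) i, `|tangent_slope S nu i| <= K%:Z.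
Proof.
exists (\max_(p : dart (ss_model S) * 'I_r.+1) `|edge_slope p.1 p.2|)%N.
move=> x nu i; have [d ->] := tangent_slope_edge nu.
by rewrite -abszE lez_nat; apply: (leq_bigmax (d, i)).
Qed.

Lemma rank_at_rank_function x : rank_function (rank_at S (x := x)).
Proof.
have [[v <-]|nv] := pselect (exists v : vertex (ss_model S),
  model_iso (inl v : ss_model S) = x); first exact: rank_at_vertex.
rewrite rank_at_standard; first exact: standard_rank_function.
by move=> v E; apply: nv; exists v.
Qed.

Lemma slopes_at_inj (f : G -> R) x (a b : cube r (tangent x)) :
  slopes_at S f a -> slopes_at S f b -> a = b.
Proof.
move=> fa fb; apply/ffunP => nu; apply: (@tangent_slope_inj _ nu).
by rewrite -fa -fb.
Qed.

(** Close to [x] the ray runs inside a single edge of the model, whose slope data is transported to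
    both tangents there. *)
Lemma local_structure x (nu : tangent x) :
  exists2 eps : R, 0 < eps & forall h, 0 < h < eps ->
    let y := dart_chart (val nu) (dart_pos x (val nu) + h) in
    [/\ 0 < dart_pos x (val nu) + h < len (val nu).1,
        forall mu : tangent y, val mu = val nu ->
          tangent_slope S mu = tangent_slope S nu,
        forall mu : tangent y, val mu = dart_rev (val nu) ->
          forall i, tangent_slope S mu i = - tangent_slope S nu (rev_ord i)
      & rank_at S (x := y) = @standard_rank r (tangent y)].
Proof.
have [d' nud'] := parallel_exists (ss_model S) nu.
have nuE := tangent_slopeE nud'.
case: nud' => p /andP[p0 pl] /near0P[e e0 eP].
have /andP[q0 ql] := dart_pos_itv (valP nu).
set d := val nu in q0 ql eP *; set q := dart_pos x d in q0 ql *.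
pose eps := Num.min e (Num.min (len d'.1 - p) (len d.1 - q)).
have eps_gt0 : 0 < eps by rewrite !lt_min e0 !subr_gt0 pl.
have [epse epsl epsl'] : [/\ eps <= e, eps <= len d'.1 - p & eps <= len d.1 - q].
  by rewrite !ge_min !lexx !orbT.
exists eps => // h hh y.
have ys : 0 < q + h < len d.1 by lra.
split=> //.
- move=> mu mud; rewrite nuE; apply: tangent_slopeE; exists (p + h); first lra.
  apply/near0P; exists (eps - h) => [|k kh]; first lra.
  rewrite -addrA eP; last lra.
  by rewrite !rayE mud {1}/y dart_pos_inner // -addrA.
- move=> mu mud i; rewrite nuE; apply/eqP; rewrite -addr_eq0.
  (* Backwards from parameter [p + h] the model dart is traversed in reverse, as long as the step
     stays below [h]. *)
  have -> : tangent_slope S mu = edge_slope (dart_rev d').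
    apply: tangent_slopeE; exists (len d'.1 - (p + h)) => /=; first lra.
    apply/near0P; exists h => [|k kh]; first lra.
    rewrite dart_chart_rev /= (_ : _ - _ = p + (h - k)); last lra.
    rewrite eP; last lra.
    rewrite !rayE mud {1}/y dart_pos_inner_rev // dart_chart_rev -/d -/q.
    by congr dart_chart; lra.
  by have := edge_slope_rev (dart_rev d') i; rewrite dart_revK => ->.
- apply: rank_at_standard => v vE.
  have := eP h ltac:(lra); rewrite rayE -/y -vE.
  have [psi isoK _] := model_iso_bij (ss_model S).
  move/(can_inj isoK).
  by have [H ->] := @dart_chart_inner _ _ d' (p + h) ltac:(lra).
Qed.

End SlopeStructures.
End LocalStructure.

(** * Piecewise affine functions of one variable *)

Section PiecewiseAffine.
Context {R : realType}.
Implicit Types (phi : R -> R) (a b s L : R) (m : int).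

Definition pl phi L := exists B : seq R, forall a b,
  0 <= a -> a < b -> b <= L -> (forall c, c \in B -> ~~ (a < c < b)) ->
  exists m, forall t, a <= t <= b -> phi t = phi a + m%:~R * (t - a).

Definition rslope phi s m := exists2 e : R, 0 < e &
  forall h, 0 < h < e -> phi (s + h) = phi s + m%:~R * h.

(** The sign is that of a derivative from the left, not of an outgoing slope. *)
Definition lslope phi s m := exists2 e : R, 0 < e &
  forall h, 0 < h < e -> phi (s - h) = phi s - m%:~R * h.

Lemma rslope_uniq phi s m m' : rslope phi s m -> rslope phi s m' -> m = m'.
Proof.
move=> [e e0 eP] [e' e'0 e'P]; apply/eqP; rewrite -(eqr_int R); apply/eqP.
have [h [h0 he he']] : exists h, [/\ 0 < h, h < e & h < e'].
  exists (Num.min e e' / 2); have : 0 < Num.min e e' by rewrite lt_min e0.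
  have [h1 h2] : Num.min e e' <= e /\ Num.min e e' <= e'.
    by rewrite !ge_min !lexx orbT.
  by split; lra.
have := eP h; have := e'P h; rewrite h0 he he' => -> // /(_ isT) E.
by apply: (mulIf (lt0r_neq0 h0)); lra.
Qed.

Lemma lslope_rslope phi s m :
  lslope phi s m <-> rslope (fun t => phi (- t)) (- s) (- m).
Proof.
by split=> -[e e0 eP]; exists e => // h he; have := eP h he;
  rewrite ?opprD ?opprK rmorphN /= => ->; lra.
Qed.

Lemma lslope_uniq phi s m m' : lslope phi s m -> lslope phi s m' -> m = m'.
Proof.
by move=> /lslope_rslope h /lslope_rslope h'; apply: oppr_inj; exact: rslope_uniq h h'.
Qed.

Lemma seq_gap_right (B : seq R) a :
  exists2 e : R, 0 < e & forall c, c \in B -> ~~ (a < c < a + e).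
Proof.
elim: B => [|c B [e e0 eP]]; first by exists 1.
have [ac|ca] := ltP a c.
  exists (Num.min e (c - a)); first by rewrite lt_min e0 subr_gt0.
  have [h1 h2] : Num.min e (c - a) <= e /\ Num.min e (c - a) <= c - a.
    by rewrite !ge_min !lexx orbT.
  move=> c'; rewrite inE => /predU1P[->|/eP/negP cB]; apply/negP => ?; first lra.
  by apply: cB; lra.
exists e => // c'; rewrite inE => /predU1P[->|/eP //]; apply/negP => ?; lra.
Qed.

Lemma seq_gap_left (B : seq R) a :
  exists2 e : R, 0 < e & forall c, c \in B -> ~~ (a - e < c < a).
Proof.
have [e e0 eP] := seq_gap_right [seq - c | c <- B] (- a).
exists e => // c cB; have /negP := eP (- c) (map_f _ cB).
by move=> h; apply/negP => ?; apply: h; lra.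
Qed.

Lemma pl_rslope phi L s : pl phi L -> 0 <= s < L -> exists m, rslope phi s m.
Proof.
move=> [B BP] sL; have [e e0 eP] := seq_gap_right B s.
pose e' := Num.min e (L - s).
have e'0 : 0 < e' by rewrite lt_min e0; lra.
have [h1 h2] : e' <= e /\ e' <= L - s by rewrite !ge_min !lexx orbT.
have [|||c cB|m mP] := BP s (s + e'); try lra.
  by have /negP h := eP c cB; apply/negP => ?; apply: h; lra.
exists m, e' => // h he; rewrite mP; lra.
Qed.

Lemma pl_lslope phi L s : pl phi L -> 0 < s <= L -> exists m, lslope phi s m.
Proof.
move=> [B BP] sL; have [e e0 eP] := seq_gap_left B s.
pose e' := Num.min e s.
have e'0 : 0 < e' by rewrite lt_min e0; lra.
have [h1 h2] : e' <= e /\ e' <= s by rewrite !ge_min !lexx orbT.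
have [|||c cB|m mP] := BP (s - e') s; try lra.
  by have /negP h := eP c cB; apply/negP => ?; apply: h; lra.
exists m, e' => // h he; rewrite (mP (s - h)) ?(mP s); lra.
Qed.

(** Induction on the number of points of [B] strictly inside: splitting at one of them removes it
    from both halves. *)
Lemma interval_ind (B : seq R) (P : R -> R -> Prop) :
  (forall a b, a < b -> (forall c, c \in B -> ~~ (a < c < b)) -> P a b) ->
  (forall a c b, a < c -> c < b -> P a c -> P c b -> P a b) ->
  forall a b, a < b -> P a b.
Proof.
move=> base step a b.
have [n] := ubnP (count (fun c => a < c < b) B); elim: n a b => // n IH a b cn ab.
have [/hasP[c cB /andP[ac cb]]|/hasPn noB] := boolP (has (fun c => a < c < b) B).
  have less (q : pred R) : (forall u, q u -> (a < u < b) && (u != c)) ->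
      (count q B < n)%N.
    move=> qP; rewrite -ltnS; apply: leq_trans cn; rewrite ltnS.
    apply: (@leq_trans (count q B + count (pred1 c) B)).
      by rewrite -addn1 leq_add2l -has_count has_pred1.
    rewrite -count_predUI (@eq_count _ (predI q (pred1 c)) pred0) ?count_pred0.
      rewrite addn0; apply: sub_count => u /orP[/qP/andP[]//|/eqP ->].
      by rewrite ac.
    by move=> u /=; apply/negbTE/negP => /andP[/qP/andP[_ /negP]].
  apply: (step a c b) => //; apply: IH => //; try lra; apply: less => u uP;
    by apply/andP; split; [lra | apply/negP => /eqP uE; lra].
by apply: base => // c /noB.
Qed.

Lemma pl_ind phi L (P : R -> R -> Prop) : pl phi L ->
  (forall a b m, 0 <= a -> a < b -> b <= L ->
     (forall t, a <= t <= b -> phi t = phi a + m%:~R * (t - a)) -> P a b) ->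
  (forall a c b, 0 <= a -> a < c -> c < b -> b <= L -> P a c -> P c b -> P a b) ->
  forall a b, 0 <= a -> a < b -> b <= L -> P a b.
Proof.
move=> [B BP] base step a b a0 ab; move: a b ab a0.
apply: (@interval_ind B) => [a b ab noB a0 bL|a c b ac cb IH1 IH2 a0 bL].
  by have [m mP] := BP a b a0 ab bL noB; exact: base mP.
by apply: (step a c b) => //; [apply: IH1 | apply: IH2]; lra.
Qed.

Lemma affine_slopes phi a b m : a < b ->
  (forall t, a <= t <= b -> phi t = phi a + m%:~R * (t - a)) ->
  rslope phi a m /\ lslope phi b m.
Proof.
move=> ab mP; split; exists (b - a); rewrite ?subr_gt0 // => h hh.
  by rewrite mP; lra.
by rewrite (mP (b - h)) ?(mP b); lra.
Qed.

Definition concave_at phi s := forall m1 m2,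
  lslope phi s m1 -> rslope phi s m2 -> m2 <= m1.

(** Gluing over affine pieces: at each cut concavity orders the slopes, so the two extreme slopes
    bound the chord. Carrying both of them in the statement makes the induction close. *)
Lemma concave_chord phi L a b : pl phi L -> 0 <= a -> a < b -> b <= L ->
  (forall s, a < s < b -> concave_at phi s) ->
  exists m1 m2, [/\ rslope phi a m1, lslope phi b m2, m2 <= m1 &
    m2%:~R * (b - a) <= phi b - phi a <= m1%:~R * (b - a)].
Proof.
move=> plphi; move: a b; apply: (pl_ind plphi) => [a b m a0 ab bL mP _|].
  have [rs ls] := affine_slopes ab mP; exists m, m; split=> //.
  by rewrite (mP b); lra.
move=> a c b a0 ac cb bL IH1 IH2 conc.
have [|m1 [m2' [rs1 ls1 m21 /andP[l1 u1]]]] := IH1; first by move=> s sac; apply: conc; lra.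
have [|m1' [m2 [rs2 ls2 m21' /andP[l2 u2]]]] := IH2; first by move=> s sac; apply: conc; lra.
have mid : m1' <= m2' by apply: conc ls1 rs2; lra.
exists m1, m2; split=> //; first lia.
have h1 : (m2%:~R : R) <= m2'%:~R by rewrite ler_int; lia.
have h2 : (m1'%:~R : R) <= m1%:~R by rewrite ler_int; lia.
have h3 : 0 <= (m2'%:~R - m2%:~R) * (c - a) by rewrite mulr_ge0; lra.
have h4 : 0 <= (m1%:~R - m1'%:~R) * (b - c) by rewrite mulr_ge0; lra.
by apply/andP; split; lra.
Qed.

Lemma rslope_chord phi L a b m : pl phi L -> 0 <= a -> a < b -> b <= L ->
  (forall s, a < s < b -> concave_at phi s) -> rslope phi a m ->
  phi b - phi a <= m%:~R * (b - a).
Proof.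
move=> p a0 ab bL conc rs.
have [m1 [m2 [rs1 _ _ /andP[_ le]]]] := concave_chord p a0 ab bL conc.
by rewrite (rslope_uniq rs rs1).
Qed.

Lemma lslope_chord phi L a b m : pl phi L -> 0 <= a -> a < b -> b <= L ->
  (forall s, a < s < b -> concave_at phi s) -> lslope phi b m ->
  m%:~R * (b - a) <= phi b - phi a.
Proof.
move=> p a0 ab bL conc ls.
have [m1 [m2 [_ ls1 _ /andP[le _]]]] := concave_chord p a0 ab bL conc.
by rewrite (lslope_uniq ls ls1).
Qed.

Lemma slope_antitone phi L a b m1 m2 : pl phi L -> 0 <= a -> a < b -> b <= L ->
  (forall s, a < s < b -> concave_at phi s) ->
  rslope phi a m1 -> lslope phi b m2 -> m2 <= m1.
Proof.
move=> p a0 ab bL conc rs ls.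
have [k1 [k2 [rs1 ls1 le _]]] := concave_chord p a0 ab bL conc.
by rewrite (lslope_uniq ls ls1) (rslope_uniq rs rs1).
Qed.

Definition slopes_in phi L (K : nat) :=
  (forall s m, 0 <= s < L -> rslope phi s m -> `|m| <= K%:Z) /\
  (forall s m, 0 < s <= L -> lslope phi s m -> `|m| <= K%:Z).

Lemma pl_lipschitz phi L (K : nat) a b : pl phi L -> slopes_in phi L K ->
  0 <= a <= L -> 0 <= b <= L -> `|phi b - phi a| <= K%:R * `|b - a|.
Proof.
move=> p [Kr _]; have aux : forall a b, 0 <= a -> a < b -> b <= L ->
    `|phi b - phi a| <= K%:R * (b - a).
  apply: (pl_ind p) => [{}a {}b m a0 ab bL mP|{}a c {}b a0 ac cb bL h1 h2].
    have [rs _] := affine_slopes ab mP.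
    rewrite (mP b); last lra.
    rewrite addrAC subrr add0r normrM (gtr0_norm (x := b - a)); last lra.
    rewrite ler_pM2r; last lra.
    by rewrite -intr_norm [leRHS]pmulrn ler_int; apply: Kr rs; lra.
  have := ler_distD (phi c) (phi b) (phi a); rewrite (_ : b - a = (b - c) + (c - a)); last lra.
  by rewrite mulrDr; lra.
move=> aL bL; have [ab|ba|->] := ltgtP a b.
- by rewrite (gtr0_norm (x := b - a)); [apply: aux; lra | lra].
- rewrite distrC (distrC b); rewrite (gtr0_norm (x := a - b)); [apply: aux; lra | lra].
- by rewrite !subrr !normr0 mulr0.
Qed.

(* Concavity on ]p, q[ in the form that survives pointwise limits. *)
Lemma concave_supergradient phi L (K : nat) p q t : pl phi L -> slopes_in phi L K ->
  0 <= p -> p < q -> q <= L ->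
  (forall s, p < s < q -> concave_at phi s) -> p <= t <= q ->
  exists2 m : int, `|m| <= K%:Z &
    forall u, p <= u <= q -> phi u <= phi t + m%:~R * (u - t).
Proof.
move=> pl1 [Kr Kl] p0 pq qL conc tpq.
(* The right slope at [t] is a supergradient; at the right end [q] only the left slope looks into
   the interval. *)
have [tq|tq] := ltP t q.
  have [|m mr] := @pl_rslope phi L t pl1; first lra.
  exists m; first by apply: Kr mr; lra.
  move=> u upq; have [ut|tu|->] := ltgtP u t; last by rewrite subrr mulr0 addr0.
    have [|m' ml] := @pl_lslope phi L t pl1; first lra.
    have mm : (m%:~R : R) <= m'%:~R by rewrite ler_int; apply: conc ml mr; lra.
    have := @lslope_chord phi L u t m' pl1 ltac:(lra) ut ltac:(lra) _ ml.
    move=> /(_ _)/wrap[]; first by move=> s su; apply: conc; lra.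
    have : 0 <= (m'%:~R - m%:~R) * (t - u) by rewrite mulr_ge0; lra.
    by lra.
  have := @rslope_chord phi L t u m pl1 ltac:(lra) tu ltac:(lra) _ mr.
  move=> /(_ _)/wrap[]; first by move=> s su; apply: conc; lra.
  by lra.
have {tq} -> : t = q by lra.
have [|m ml] := @pl_lslope phi L q pl1; first lra.
exists m; first by apply: Kl ml; lra.
move=> u upq; have [->|uq] := eqVneq u q; first by rewrite subrr mulr0 addr0.
have {}uq : u < q by rewrite lt_neqAle uq; lra.
have := @lslope_chord phi L u q m pl1 ltac:(lra) uq ltac:(lra) _ ml.
move=> /(_ _)/wrap[]; first by move=> s su; apply: conc; lra.
by lra.
Qed.

End PiecewiseAffine.

(** * Rational functions along darts *)

Section DartFunctions.
Context {R : realType} (G : metric_graph R).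
Implicit Types (x y z : G) (d : dart G) (f : G -> R).

Definition on_dart f d (t : R) := f (dart_chart d t).

Lemma on_dart_rev f d t : on_dart f (dart_rev d) t = on_dart f d (len d.1 - t).
Proof. by rewrite /on_dart dart_chart_rev. Qed.

Lemma on_dart_pl f d : rational_fun f -> pl (on_dart f d) (len d.1).
Proof.
move=> [_ fpl]; case: d => e b; have [B BP] := fpl e.
case: b; first by exists B.
exists [seq len e - c | c <- B] => a b a0 ab bL noB.
have [|||c cB|m mP] := BP (len e - b) (len e - a); try by move: bL => /=; lra.
  have /negP h := noB (len e - c) (map_f _ cB); apply/negP => ?; apply: h.
  by rewrite /= in bL *; lra.
exists (- m) => t tab; rewrite /on_dart /dart_chart /=.
rewrite (mP (len e - t)) ?(mP (len e - a)); lra.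
Qed.

(** [slope] is a choice with default value 0; uniqueness of right slopes identifies the chosen
    integer. *)
Lemma slopeE f x (nu : tangent x) (m : int) :
  rslope (on_dart f (val nu)) (dart_pos x (val nu)) m -> slope f nu = m.
Proof.
have key (k : int) : (\forall h \near 0^'+, f (ray nu h) = f x + k%:~R * h) <->
    rslope (on_dart f (val nu)) (dart_pos x (val nu)) k.
  rewrite near0P; split=> -[e e0 eP]; exists e => // h he.
    by rewrite /on_dart -rayE eP // dart_chart_pos // (valP nu).
  by rewrite rayE -[LHS]/(on_dart f _ _) eP // /on_dart dart_chart_pos // (valP nu).
move=> rm; rewrite /slope; case: xgetP => [k _ /key rk|/(_ m)[]].
  exact: rslope_uniq rk rm.
exact/key.
Qed.

Lemma slope_rslope f x (nu : tangent x) : rational_fun f ->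
  rslope (on_dart f (val nu)) (dart_pos x (val nu)) (slope f nu).
Proof.
move=> fr; have [m mr] := pl_rslope (on_dart_pl (val nu) fr) (dart_pos_itv (valP nu)).
by rewrite (slopeE mr).
Qed.

Lemma rslope_on_dart_rev f d s m : rslope (on_dart f (dart_rev d)) (len d.1 - s) m <->
  lslope (on_dart f d) s (- m).
Proof.
split=> -[e e0 eP]; exists e => // h he; have := eP h he; rewrite !on_dart_rev rmorphN.
  by rewrite (_ : len d.1 - (len d.1 - s + h) = s - h) 1?(_ : len d.1 - (len d.1 - s) = s); lra.
by rewrite (_ : len d.1 - (len d.1 - s + h) = s - h) 1?(_ : len d.1 - (len d.1 - s) = s); lra.
Qed.

Lemma inner_rslope f d s (nu : tangent (dart_chart d s)) : rational_fun f ->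
  0 < s < len d.1 -> val nu = d -> rslope (on_dart f d) s (slope f nu).
Proof.
by move=> fr ds nud; have := slope_rslope nu fr; rewrite nud dart_pos_inner.
Qed.

Lemma inner_lslope f d s (nu : tangent (dart_chart d s)) : rational_fun f ->
  0 < s < len d.1 -> val nu = dart_rev d -> lslope (on_dart f d) s (- slope f nu).
Proof.
move=> fr ds nud; have := slope_rslope nu fr.
by rewrite nud dart_pos_inner_rev // => /rslope_on_dart_rev.
Qed.

(** Off the support of [D] the order is nonnegative, so the two outgoing slopes have sum at most 0;
    the backward one is minus the left slope. *)
Lemma ord_concave (D : divisor G) f d s : RatD D f -> 0 < s < len d.1 ->
  D (dart_chart d s) = 0 -> concave_at (on_dart f d) s.
Proof.
move=> [fr /(_ (dart_chart d s))] + ds D0; rewrite D0 add0r /ord.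
have [[nu nud] [mu mud]] := inner_tangents ds.
rewrite (sum_inner _ ds nud mud) => ord0 m1 m2.
move=> /lslope_uniq /(_ (inner_lslope fr ds mud)) ->.
move=> /rslope_uniq /(_ (inner_rslope fr ds nud)) ->; lia.
Qed.

Definition bounded_slopes f (K : nat) :=
  forall x (nu : tangent x), `|slope f nu| <= K%:Z.

Lemma bounded_slopes_in f K d : rational_fun f -> bounded_slopes f K ->
  slopes_in (on_dart f d) (len d.1) K.
Proof.
move=> fr fK; have aux d' s m : 0 <= s < len d'.1 ->
    rslope (on_dart f d') s m -> `|m| <= K%:Z.
  move=> /andP[]; rewrite le_eqVlt => /predU1P[<- _ rm|s0 sl rm].
    have d'x : d' \in outgoing (dart_chart d' 0) by rewrite dart_chart0 inE.
    have <- : slope f (Sub d' d'x : tangent (dart_chart d' 0)) = m; last exact: fK.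
    by apply: slopeE; rewrite SubK dart_chart0.
  have [|[nu nud] _] := @inner_tangents _ _ d' s; first by rewrite s0.
  have <- : slope f nu = m; last exact: fK.
  by apply: slopeE; rewrite nud dart_pos_inner // s0.
split; first exact: aux.
move=> s m sl; rewrite -(opprK m) => /rslope_on_dart_rev rm.
by rewrite normrN; apply: aux rm => /=; lra.
Qed.

Lemma path_lipschitz f (K : nat) x y l : rational_fun f -> bounded_slopes f K ->
  path_length x y l -> `|f y - f x| <= K%:R * l.
Proof.
move=> fr fK; elim=> [|e s t k hs ht _ IH]; first by rewrite subrr normr0 mulr0.
have h := @pl_lipschitz _ _ _ K s t (on_dart_pl (e, true) fr)
  (bounded_slopes_in _ fr fK) hs ht.
rewrite mulrDr; apply: le_trans (ler_distD (f (chart e s)) _ _) _.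
by rewrite addrC lerD.
Qed.

Lemma lipschitz_continuous f (K : nat) :
  (forall x y l, path_length x y l -> `|f y - f x| <= K%:R * l) -> continuous f.
Proof.
move=> fK x B /nbhs_ballP[e /= e0 eB].
(* The successor keeps the radius meaningful when [K] is 0. *)
have eK : 0 < e / K.+1%:R by rewrite divr_gt0 // ltr0n.
apply: (@filterS _ _ (@nbhs_filter G x) _ _ _ (nbhsx_ballx x _ eK)) => y xy.
apply: eB; rewrite /ball /=.
have [l xl] : exists2 l, path_length x y l & l < e / K.+1%:R.
  by apply: inf_lt xy; have [] := path_length_has_inf x y.
rewrite ltr_pdivlMr ?ltr0n // => le; rewrite distrC.
apply: le_lt_trans (fK _ _ _ xl) _; apply: le_lt_trans le.
by rewrite mulrC ler_wpM2l ?ler_nat // (path_length_ge0 xl).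
Qed.

End DartFunctions.

(** * Pointwise limits *)

Section Limits.
Context {R : realType}.
Implicit Types (phi : R -> R) (a b p q t : R) (u : nat -> R).

(** Along an ultrafilter every bounded sequence converges, so limits at all points of the graph
    exist at once, without extracting subsequences. *)
Definition ulim (U : set_system nat) u l :=
  forall e, 0 < e -> U [set n | `|u n - l| < e].

Lemma ulim_exists (U : set_system nat) u (C : R) : UltraFilter U ->
  (forall n, `|u n| <= C) -> exists l, ulim U u l.
Proof.
move=> UU uC.
have [|l [_ cl]] := @segment_compact R (- C) C (fmap u U) _.
  apply: (@filterS _ U _ setT _ _ filterT) => n _ /=.
  by rewrite in_itv /= -ler_norml uC.
exists l => e e0.
have [//|Uc] := in_ultra_setVsetC [set n | `|u n - l| < e] UU.
have [|x [/= ux lx]] := cl (~` ball l e) (ball l e) _ (nbhsx_ballx l e e0).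
  apply: (@filterS _ U _ (~` [set n | `|u n - l| < e]) _ _ Uc) => n /= h lu.
  by apply: h; rewrite distrC.
by case: ux.
Qed.

Lemma ulim_close (U : set_system nat) (I : finType) (u : I -> nat -> R) (l : I -> R) e :
  UltraFilter U -> (forall i, ulim U (u i) (l i)) -> 0 < e ->
  U [set n | forall i, `|u i n - l i| < e].
Proof.
by move=> UU ul e0; apply: (@filter_forall _ I (fun i n => `|u i n - l i| < e)) => i; exact: ul.
Qed.

Lemma bounded_int_ord (K : nat) (m : int) : `|m| <= K%:Z ->
  exists i : 'I_(K + K).+1, m = i%:Z - K%:Z.
Proof.
move=> mK; have h : (`|(m + K%:Z)%R| < (K + K).+1)%N by lia.
by exists (Ordinal h) => /=; lia.
Qed.

(** Only finitely many integers are candidates. If each failed for the limit, at its own point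
    [s_ i], a function close to the limit at these points and at [t] would have no supergradient
    either. *)
Lemma supergradient_limit (U : set_system nat) (phi_ : nat -> R -> R) phi (K : nat) p q t :
  UltraFilter U -> (forall s, p <= s <= q -> ulim U (phi_ ^~ s) (phi s)) ->
  p <= t <= q ->
  (forall n, exists2 m : int, `|m| <= K%:Z &
    forall s, p <= s <= q -> phi_ n s <= phi_ n t + m%:~R * (s - t)) ->
  exists2 m : int, `|m| <= K%:Z &
    forall s, p <= s <= q -> phi s <= phi t + m%:~R * (s - t).
Proof.
move=> UU lim tpq sg; apply: contrapT => no.
pose m_ (i : 'I_(K + K).+1) : int := i%:Z - K%:Z.
have bad (i : 'I_(K + K).+1) :
    exists s, p <= s <= q /\ phi t + (m_ i)%:~R * (s - t) < phi s.
  apply: contrapT => noi; apply: no; exists (m_ i).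
    by rewrite /m_; have := ltn_ord i; lia.
  by move=> s spq; rewrite leNgt; apply/negP => h; apply: noi; exists s.
have [s_ s_P] := choice bad.
pose d := \big[Num.min/1]_i (phi (s_ i) - phi t - (m_ i)%:~R * (s_ i - t)).
have d0 : 0 < d.
  rewrite /d; elim/big_ind: _ => [|a b a0 b0|i _]; first exact: ltr01.
    by rewrite lt_min a0.
  by have [_] := s_P i; lra.
have dle i : d <= phi (s_ i) - phi t - (m_ i)%:~R * (s_ i - t).
  by rewrite /d (bigD1 i) //= ge_min lexx.
have d20 : 0 < d / 2 by lra.
have [n [nt ns]] := filter_ex (filterI (lim t tpq _ d20)
  (ulim_close UU (fun i => lim (s_ i) (s_P i).1) d20)).
have [m mK mP] := sg n; have [i mE] := bounded_int_ord mK.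
have := mP (s_ i) (s_P i).1; have := ns i; have := dle i; move: nt => /=.
rewrite /m_ -mE !ltr_norml; lra.
Qed.

(* The supergradients at two points with the same slope span the same affine
   function, so the graph is the minimum of finitely many lines; it can only
   break where two of them cross. *)
Lemma supergradient_affine phi (K : nat) p q :
  (forall t, p <= t <= q -> exists2 m : int, `|m| <= K%:Z &
    forall s, p <= s <= q -> phi s <= phi t + m%:~R * (s - t)) ->
  exists B : seq R, forall a b, p <= a -> a < b -> b <= q ->
    (forall c, c \in B -> ~~ (a < c < b)) ->
    exists m : int, forall t, a <= t <= b -> phi t = phi a + m%:~R * (t - a).
Proof.
move=> sg.
pose T (m : int) t := p <= t <= q /\
  forall s, p <= s <= q -> phi s <= phi t + m%:~R * (s - t).
have Taff (m : int) : exists c : R, forall t, T m t -> phi t = m%:~R * t + c.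
  have [[t0 [t0pq T0]]|no] := pselect (exists t, T m t).
    exists (phi t0 - m%:~R * t0) => t [tpq Tt].
    by have := T0 t tpq; have := Tt t0 t0pq; lra.
  by exists 0 => t Tt; exfalso; apply: no; exists t.
have [c cP] := choice Taff.
have le_line (m : int) t s : T m t -> p <= s <= q -> phi s <= m%:~R * s + c m.
  by move=> Tt spq; have := cP m t Tt; have := Tt.2 s spq; lra.
pose ms : seq int := [seq i%:Z - K%:Z | i <- iota 0 (K + K).+1].
have msP (m : int) : `|m| <= K%:Z -> m \in ms.
  move=> /bounded_int_ord[i ->]; apply/mapP; exists (i : nat) => //.
  by rewrite mem_iota /= add0n ltn_ord.
(* Crossing points of the lines; for [i = j] the quotient is 0 by convention and only adds a
   harmless breakpoint. *)
pose B := [seq (c i - c j) / (j%:~R - i%:~R) | i <- ms, j <- ms].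
exists B => a b pa ab bq noB.
pose t0 := (a + b) / 2.
have [|m mK mT] := sg t0; first by rewrite /t0; lra.
have T0 : T m t0 by split => //; rewrite /t0; lra.
have t0E := cP m t0 T0.
suff E t : a <= t <= b -> phi t = m%:~R * t + c m.
  by exists m => t tab; rewrite (E t tab) (E a); lra.
move=> tab; have tpq : p <= t <= q by lra.
have [k kK kT] := sg t tpq; have T1 : T k t by [].
have tE := cP k t T1.
have h1 := le_line m t0 t T0 tpq.
have h2 := le_line k t t0 T1 T0.1.
(* If [phi t] were below the line through the midpoint [t0], the lines of slopes [k] and [m] would
   cross between [t] and [t0], at a point of [B] inside the interval. *)
apply/eqP; rewrite eq_le h1 leNgt; apply/negP => h3.
have km : (k%:~R - m%:~R : R) != 0.
  by apply/eqP => km; have E : (k%:~R : R) = m%:~R by [lra]; rewrite E in tE h2; lra.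
pose s := (c m - c k) / (k%:~R - m%:~R).
have sB : s \in B by apply/allpairsP; exists (m, k); split; rewrite ?msP.
have sE : (k%:~R - m%:~R) * s = c m - c k by rewrite /s mulrC divfK.
have /negP := noB s sB; apply.
have hs (w : R) : (k%:~R - m%:~R) * (w - s) = (k%:~R * w + c k) - (m%:~R * w + c m).
  by rewrite mulrBr sE; lra.
have i1 : (k%:~R - m%:~R) * (t - s) < 0 by rewrite hs; lra.
have i2 : 0 <= (k%:~R - m%:~R) * (t0 - s) by rewrite hs; lra.
have := tab; rewrite /t0 in i2.
have [pos|neg|E] := ltgtP (k%:~R - m%:~R : R) 0; last by rewrite E eqxx in km.
  move: i1 i2; rewrite nmulr_rlt0 // nmulr_rge0 // => *; lra.
move: i1 i2; rewrite pmulr_rlt0 // pmulr_rge0 // => *; lra.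
Qed.


End Limits.

Section PointwiseLimits.
Context {R : realType} (G : metric_graph R).
Variables (D : divisor G) (K : nat) (U : set_system nat) (F : nat -> G -> R) (g : G -> R).
Hypotheses (UU : UltraFilter U) (FD : forall n, RatD D (F n))
  (FK : forall n, bounded_slopes (F n) K)
  (Fg : forall y, ulim U (F ^~ y) (g y)).

Lemma limit_lipschitz (x y : G) l : path_length x y l -> `|g y - g x| <= K%:R * l.
Proof.
move=> xy; rewrite leNgt; apply/negP => h.
pose e := (`|g y - g x| - K%:R * l) / 2.
have e0 : 0 < e by rewrite /e; lra.
have [n [nx ny]] := filter_ex (filterI (Fg x e0) (Fg y e0)).
have := path_lipschitz (FD n).1 (FK n) xy.
have : `|g y - g x| <= `|F n y - g y| + `|F n y - F n x| + `|F n x - g x|.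
  rewrite (_ : g y - g x = - (F n y - g y) + (F n y - F n x) + (F n x - g x)); last lra.
  apply: le_trans (ler_normD _ _) _; rewrite lerD2r.
  by apply: le_trans (ler_normD _ _) _; rewrite normrN.
by rewrite /= in nx ny; rewrite /e in nx ny; lra.
Qed.

Definition support_on (e : edge G) : seq R :=
  pmap (fun p : G => if p is inr q then
    if (val q).1 == e then Some (val q).2 else None else None) (finsupp D).

Lemma support_onP e s : 0 < s < len e -> s \notin support_on e ->
  D (chart e s) = 0.
Proof.
move=> es sN; have [//|Ds] := eqVneq (D (chart e s)) 0; case/negP: sN.
rewrite mem_pmap; apply/mapP; exists (chart e s); first by rewrite mem_finsupp.
by rewrite chart_inner /= eqxx.
Qed.

(** Cut the edge at the support of [D]. On each piece all [F n] are concave with slopes in a fixed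
    finite set, and their supergradients survive the limit. *)
Lemma limit_piecewise_affine : piecewise_affine_int g.
Proof.
move=> e; pose phi := on_dart g (e, true).
suff : forall a b, a < b -> 0 <= a -> b <= len e -> exists B : seq R,
    forall a' b', a <= a' -> a' < b' -> b' <= b ->
    (forall c, c \in B -> ~~ (a' < c < b')) ->
    exists m : int, forall t, a' <= t <= b' -> phi t = phi a' + m%:~R * (t - a').
  by move/(_ 0 (len e) (len_gt0 e) (lexx 0) (lexx _)).
apply: (@interval_ind _ (support_on e)) => [p q pq noB p0 qL|a c b ac cb IH1 IH2 a0 bL].
  apply: (@supergradient_affine _ phi K p q) => t tpq.
  apply: (supergradient_limit (phi_ := fun n => on_dart (F n) (e, true)) UU) => //.
    by move=> s _; exact: Fg.
  move=> n; apply: (@concave_supergradient _ _ (len e) K) => //.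
  - exact: (@on_dart_pl _ _ _ (e, true) (FD n).1).
  - exact: (@bounded_slopes_in _ _ _ _ (e, true) (FD n).1).
  - move=> s spq; apply: (ord_concave (D := D) (FD n)) => /=; first lra.
    apply: support_onP; first lra.
    by apply/negP => /noB; rewrite spq.
have [|B1 B1P] := IH1 a0; first lra.
have [|B2 B2P] := IH2 _ bL; first lra.
exists (c :: B1 ++ B2) => a' b' aa' a'b' b'b noB.
have [b'c|cb'] := leP b' c.
  by apply: B1P => // u uB; apply: noB; rewrite inE mem_cat uB orbT.
have ca' : c <= a'.
  by rewrite leNgt; apply/negP => ac'; have := noB c (mem_head _ _); rewrite ac' cb'.
by apply: B2P => // u uB; apply: noB; rewrite inE mem_cat uB !orbT.
Qed.

Lemma limit_rational : rational_fun g.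
Proof.
split; last exact: limit_piecewise_affine.
exact: (lipschitz_continuous limit_lipschitz).
Qed.

(** Closeness on a finite grid spreads to all points through the common Lipschitz constant [K]. *)
Lemma limit_uniform (e : R) : 0 < e -> exists n, forall y, `|F n y - g y| < e.
Proof.
move=> e0.
have [L L0 LP] : exists2 L : R, 0 < L & forall d : edge G, len d <= L.
  exists (1 + \sum_(d : edge G) len d).
    by apply: (lt_le_trans ltr01); rewrite lerDl sumr_ge0 // => d _; rewrite ltW ?len_gt0.
  move=> d; rewrite (bigD1 d) //= addrCA lerDl addr_ge0 // sumr_ge0 // => i _.
  by rewrite ltW ?len_gt0.
(* Chosen so that one grid step changes a [K]-Lipschitz function by less than [e / 3]. *)
pose N := (Num.truncn (3 * K%:R * L / e)).+1.
have NP : K%:R * (L / N%:R) < e / 3.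
  have := truncnS_gt (3 * K%:R * L / e); rewrite -/N ltr_pdivrMr // => h.
  rewrite mulrA ltr_pdivrMr ?ltr0n //; lra.
pose h := L / N%:R; rewrite -/h in NP.
have h0 : 0 < h by rewrite divr_gt0 ?ltr0n.
have e30 : 0 < e / 3 by lra.
(* The same grid serves all edges; on a shorter edge the surplus parameters give its end point,
   which does no harm. *)
have [n nP] := filter_ex (ulim_close
  (u := fun (p : edge G * 'I_N.+1) n => F n (chart p.1 (p.2%:R * h)))
  (l := fun p => g (chart p.1 (p.2%:R * h))) UU (fun p => Fg _) e30).
exists n => y.
have [nu _] := exists_tangent y.
have [d [t tl ->]] : exists d, exists2 t : R, 0 <= t <= len d & y = chart d t.
  exists (val nu).1, (dart_coord (val nu) (dart_pos y (val nu))).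
    by rewrite dart_coord_itv; have := dart_pos_itv (valP nu); lra.
  by rewrite -[LHS](dart_chart_pos (valP nu)).
have /andP[j1 j2] := truncn_itv (divr_ge0 (andP tl).1 (ltW h0)).
set j := Num.truncn (t / h) in j1 j2.
rewrite ler_pdivlMr // in j1; rewrite ltr_pdivrMr // in j2.
rewrite -natr1 mulrDl mul1r in j2.
have jN : (j < N.+1)%N.
  rewrite ltnS -(ler_nat R) -(ler_pM2r h0); apply: le_trans j1 _.
  by rewrite /h mulrCA divff ?mulr1 ?pnatr_eq0 //; have := LP d; lra.
have := nP (d, Ordinal jN); rewrite /=; set s := j%:R * h in j1 j2 *.
have s0 : 0 <= s by rewrite mulr_ge0 ?ler0n ?ltW.
have st : path_length (chart d s) (chart d t) `|t - s|.
  by apply: path_length_edge; lra.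
have := limit_lipschitz st; have := path_lipschitz (FD n).1 (FK n) st.
have : K%:R * `|t - s| <= K%:R * h.
  by rewrite ler_wpM2l ?ler0n // ger0_norm; lra.
rewrite (_ : F n (chart d t) - g (chart d t) =
  (F n (chart d t) - F n (chart d s)) + (F n (chart d s) - g (chart d s)) -
  (g (chart d t) - g (chart d s))); last lra.
move=> a1 a2 a3 a4.
apply: le_lt_trans (ler_normB _ _) _.
have := ler_normD (F n (chart d t) - F n (chart d s)) (F n (chart d s) - g (chart d s)).
lra.
Qed.


End PointwiseLimits.

Lemma sup_closed_uniform {R : realType} (G : metric_graph R) (M : set (G -> R)) (g : G -> R) :
  sup_closed M -> rational_fun g ->
  (forall e : R, 0 < e -> exists2 f, M f & forall y, `|f y - g y| < e) -> M g.
Proof.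
move=> cl gr app; apply: cl; split=> // B /uniform_nbhs[E [entE EB]].
have [e /= e0 eE] : exists2 e : R, 0 < e & forall a b : R, ball a e b -> E (a, b).
  move: entE; rewrite -entourage_ballE => -[e e0 eE].
  by exists e => // a b ab; apply: eE.
have [f Mf fg] := app e e0; exists f; split=> //; apply: EB => y _ /=.
by apply: eE; rewrite /ball /= distrC.
Qed.

(** * Compactness of an admissible semimodule modulo constants *)

Section AdmissibleLimits.
Context {R : realType} (G : metric_graph R).
Variables (D : divisor G) (M : set (G -> R)) (r : nat) (S : slope_structure G r).
Hypothesis adm : admissible D M S.

Lemma admissible_RatD f : M f -> RatD D f.
Proof. by case: adm => _ h _ _ _ /h. Qed.

Lemma admissible_rational f : M f -> rational_fun f.
Proof. by move/admissible_RatD => []. Qed.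

Lemma admissible_jump f x : M f ->
  exists2 a : cube r (tangent x), slopes_at S f a & jump (rank_at S (x := x)) a.
Proof. by case: adm => _ _ _ h _ /h[_ /(_ x)[_]]. Qed.

Lemma admissible_bounded : exists K, forall f, M f -> bounded_slopes f K.
Proof.
have [K KP] := tangent_slope_bounded S; exists K => f Mf x nu.
by have [a -> _] := admissible_jump x Mf.
Qed.

(** Translated to value 0 at [x0], the functions are bounded at each point by their common Lipschitz
    constant, so they have a limit along an ultrafilter; they approximate it uniformly, hence it
    lies in [M]. That [U] refines [\oo] keeps eventual properties usable. *)
Lemma admissible_limit (F : nat -> G -> R) : (forall n, M (F n)) ->
  exists (U : set_system nat) (g : G -> R) (c : nat -> R),
    [/\ UltraFilter U, \oo `<=` U, M g &
      forall y, ulim U (fun n => F n y + c n) (g y)].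
Proof.
move=> MF; have [[_ _ add] _ cl _ _] := adm.
have [U [UU oU]] := ultraFilterLemma eventually_filter.
have [K KP] := admissible_bounded.
have [x0] : exists x0 : G, True.
  by have /card_gt0P[e _] := edge_exists G; exists (chart e 0).
move=> _; pose c n := - F n x0.
pose F' n y := F n y + c n.
have MF' n : M (F' n) by exact: add.
have bd y : exists l, ulim U (F' ^~ y) l.
  have [l xy] := path_length_exists x0 y.
  apply: (@ulim_exists _ U _ (K%:R * l)) => n; rewrite /F' /c.
  exact: path_lipschitz (admissible_rational (MF n)) (KP _ (MF n)) xy.
have [g gP] := choice bd.
exists U, g, c; split=> //.
have FD n := admissible_RatD (MF' n); have FK n := KP _ (MF' n).
apply: sup_closed_uniform => //; first exact: limit_rational UU FD FK gP.
by move=> e e0; have [n nP] := limit_uniform UU FD FK gP e0; exists (F' n).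
Qed.

End AdmissibleLimits.

(** * Slopes of admissible semimodules *)

Section SeqDivisor.
Context {R : realType} (G : metric_graph R).

Definition seq_divisor (s : seq G) : divisor G :=
  [fsfun y in [fset y | y in s]%fset => (count_mem y s)%:Z | 0].

Lemma seq_divisorE (s : seq G) y : seq_divisor s y = (count_mem y s)%:Z.
Proof.
rewrite fsfunE inE; case: ifP => // /negbT ys.
by rewrite (count_memPn ys).
Qed.

Lemma deg_seq_divisor (s : seq G) : deg (seq_divisor s) = (size s)%:Z.
Proof.
rewrite /deg (eq_bigr _ (fun y _ => seq_divisorE s y)).
have : {subset s <= finsupp (seq_divisor s)}.
  move=> y ys; rewrite mem_finsupp seq_divisorE eqz_nat -lt0n.
  by rewrite -has_count has_pred1.
move: (finsupp _) (fset_uniq (finsupp (seq_divisor s))) => T uT.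
elim: s => [|z s IH] zsT; first by rewrite big1.
rewrite /= intS -IH => [|y ys]; last by apply: zsT; rewrite inE ys orbT.
rewrite (eq_bigr (fun y => (z == y)%:Z + (count_mem y s)%:Z)) => [|y _]; last by rewrite PoszD.
rewrite big_split /=; congr (_ + _).
rewrite (bigD1_seq z) ?zsT ?mem_head //= eqxx big1 ?addr0 // => y.
by rewrite eq_sym => /negbTE ->.
Qed.

End SeqDivisor.

Section Admissible.
Context {R : realType} (G : metric_graph R).
Variables (D : divisor G) (M : set (G -> R)) (r : nat) (S : slope_structure G r).
Hypothesis adm : admissible D M S.

(** The rank half of the admissibility condition, for the divisor given by [s]. *)
Definition dominates (s : seq G) (f : G -> R) := forall y,
  exists2 a : cube r (tangent y), slopes_at S f a & (count_mem y s)%:Z <= rank_at S a.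

Lemma admissible_seq s : size s = r -> exists2 f, M f & dominates s f.
Proof.
move=> sr; have [_ _ _ _ h] := adm.
have [||f Mf fP] := h (seq_divisor s).
- by move=> y; rewrite seq_divisorE.
- by rewrite deg_seq_divisor sr.
exists f => // y; have [[a fa aP] _] := fP y; exists a => //.
by rewrite -seq_divisorE.
Qed.

Definition ray_nice (x : G) (nu : tangent x) (h : R) :=
  let y := dart_chart (val nu) (dart_pos x (val nu) + h) in
  [/\ 0 < dart_pos x (val nu) + h < len (val nu).1,
      forall mu : tangent y, val mu = val nu ->
        tangent_slope S mu = tangent_slope S nu,
      forall mu : tangent y, val mu = dart_rev (val nu) ->
        forall i, tangent_slope S mu i = - tangent_slope S nu (rev_ord i),
      rank_at S (x := y) = @standard_rank r (tangent y)
    & D y = 0].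

Lemma ray_nice_near (x : G) (nu : tangent x) :
  exists2 e : R, 0 < e & forall h, 0 < h < e -> ray_nice nu h.
Proof.
have [e e0 eP] := local_structure S nu.
have [e' e'0 e'P] := ray_avoids nu (finsupp D).
exists (Num.min e e') => [|h]; first by rewrite lt_min e0.
rewrite lt_min => /and3P[h0 he he']; have [|? ? ? ?] := eP h; first by rewrite h0.
have := e'P h; rewrite h0 => /(_ he'); rewrite memNfinsupp => /eqP.
by split.
Qed.

Lemma ray_nice_concave (x : G) (nu : tangent x) h f : M f -> ray_nice nu h ->
  concave_at (on_dart f (val nu)) (dart_pos x (val nu) + h).
Proof. by move=> Mf [? _ _ _ ?]; apply: ord_concave (admissible_RatD adm Mf) _ _. Qed.

(** The standard rank on two coordinates bounds the sum of the two indices by [r - k]. Read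
    forwards, a backward index [q] becomes [r - q], so the slope index falls by at least [k] across
    the point. *)
Lemma ray_nice_slopes (x : G) (nu : tangent x) h f (k : nat)
    (a : cube r (tangent (dart_chart (val nu) (dart_pos x (val nu) + h)))) :
  M f -> ray_nice nu h -> slopes_at S f a -> k%:Z <= rank_at S a ->
  exists i j : 'I_r.+1, [/\ (i + k <= j)%N,
    rslope (on_dart f (val nu)) (dart_pos x (val nu) + h) (tangent_slope S nu i) &
    lslope (on_dart f (val nu)) (dart_pos x (val nu) + h) (tangent_slope S nu j)].
Proof.
move=> Mf [ds fwd bwd rkE _] fa; rewrite rkE /standard_rank => ka.
have fr := admissible_rational adm Mf.
have [[nu' nuE] [mu' muE]] := inner_tangents ds.
have rs := inner_rslope fr ds nuE; have ls := inner_lslope fr ds muE.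
move: ka; rewrite (sum_inner _ ds nuE muE) => ka.
exists (a nu'), (rev_ord (a mu')); split.
- have aux (i j : nat) : k%:Z <= Num.max (-1) (r%:Z - (i%:Z + j%:Z)) ->
      (i + k <= r - j)%N by lia.
  by rewrite /= subSS; exact: aux ka.
- by move: rs; rewrite (fa nu') fwd.
- by move: ls; rewrite (fa mu') bwd // opprK.
Qed.

Lemma realize_slope (x : G) (nu : tangent x) (i : 'I_r.+1) (e : R) : 0 < e ->
  exists2 f, M f & exists2 h, 0 < h < e &
    rslope (on_dart f (val nu)) (dart_pos x (val nu) + h) (tangent_slope S nu i).
Proof.
move=> e0; have [e' e'0 nice] := ray_nice_near nu.
set d := val nu in nice *; set p := dart_pos x d in nice *.
pose h := Num.min e e' / 3.
have [h0 he he'] : [/\ 0 < h, 3 * h <= e & 3 * h <= e'].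
  have : 0 < Num.min e e' by rewrite lt_min e0.
  have [l1 l2] : Num.min e e' <= e /\ Num.min e e' <= e' by rewrite !ge_min !lexx orbT.
  by rewrite /h; split; lra.
pose y1 := dart_chart d (p + h); pose y2 := dart_chart d (p + 2 * h).
(* Multiplicity [r - i] at [y1] gives [i1 <= i], and [i] at [y2] gives [i <= j2]; concavity in
   between closes the circle with [j2 <= i1]. *)
have [|f Mf fP] := admissible_seq (s := nseq (r - i) y1 ++ nseq i y2).
  by rewrite size_cat !size_nseq subnK // -ltnS.
have fr := admissible_rational adm Mf.
have n1 : ray_nice nu h by apply: nice; lra.
have n2 : ray_nice nu (2 * h) by apply: nice; lra.
exists f => //; exists h; first lra.
have [a1 fa1 c1] := fP y1; have [a2 fa2 c2] := fP y2.
have [|i1 [j1 [le1 rs1 ls1]]] := @ray_nice_slopes _ nu h f (r - i) a1 Mf n1 fa1.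
  by apply: le_trans c1; rewrite lez_nat count_cat count_nseq /= eqxx mul1n leq_addr.
have [|i2 [j2 [le2 rs2 ls2]]] := @ray_nice_slopes _ nu (2 * h) f i a2 Mf n2 fa2.
  by apply: le_trans c2; rewrite lez_nat count_cat !count_nseq /= eqxx mul1n leq_addl.
have : tangent_slope S nu j2 <= tangent_slope S nu i1.
  have [in1 _ _ _ _] := n1; have [in2 _ _ _ _] := n2; rewrite -/d -/p in in1 in2.
  apply: (slope_antitone (on_dart_pl d fr) _ _ _ _ rs1 ls2); rewrite -?/d -?/p; try lra.
  move=> s sh; rewrite (_ : s = p + (s - p)); last lra.
  by apply: ray_nice_concave => //; apply: nice; lra.
rewrite tangent_slope_le => ji; suff <- : i1 = i by [].
by apply/val_inj => /=; have := ltn_ord j1; have := ltn_ord i; lia.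
Qed.

Lemma shrinking_seq (e : R) : 0 < e -> exists t_ : nat -> R,
  (forall n, 0 < t_ n < e) /\
  forall e' : R, 0 < e' -> \forall n \near \oo, 0 < t_ n < e'.
Proof.
(* The offset 2 makes already the term at index 0 smaller than [e]. *)
move=> e0; exists (fun n => e / n.+2%:R).
have pos n : 0 < e / n.+2%:R by rewrite divr_gt0 ?ltr0n.
split=> [n|e' e'0].
  by rewrite pos ltr_pdivrMr ?ltr0n // ltr_pMr // (ltr_nat R 1).
exists (Num.truncn (e / e')) => // n /= len; rewrite pos /=.
rewrite ltr_pdivrMr ?ltr0n // mulrC -ltr_pdivrMr //.
apply: lt_le_trans (truncnS_gt _) _; rewrite ler_nat ltnS; exact: leqW.
Qed.

Lemma int_lt_succ (a b j : int) : (a%:~R - b%:~R + j%:~R : R) < 1 -> a <= b - j.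
Proof. by rewrite -intrB -intrD -[ltRHS](mulr1z 1) ltr_int; lia. Qed.

(** The numerical core of [slope_limit_drop]: [vp], [vt], [vh] are values of [F n] at [p], [p + t],
    [p + h], and [gp], [gh] those of the limit. The error is [h / 2] from convergence plus at most
    [t < h / 4], in total less than [h]. *)
Lemma drop_estimate (vp vt vh gp gh p h t sF sg m j : R) :
  0 < h -> 0 < t < h / 4 -> j <= 1 -> m <= sF - j ->
  - (h / 2) < vh - vp - (gh - gp) -> gh = gp + sg * h ->
  vt - vp <= sF * (p + t - p) -> vh - vt <= m * (p + h - (p + t)) ->
  sg - sF + j < 1.
Proof.
move=> h0 /andP[t0 th] j1 mj low ghE.
rewrite addrAC subrr add0r opprD addrACA subrr add0r => i1 i2.
have m2 : m * (h - t) <= (sF - j) * (h - t) by rewrite ler_wpM2r //; lra.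
have jt : j * t <= t by rewrite ler_piMl // ltW.
rewrite -(ltr_pM2r h0) mul1r.
have E : (sg - sF + j) * h = (gh - gp) - (sF * t + (sF - j) * (h - t)) + j * t.
  by rewrite ghE; ring.
rewrite E; lra.
Qed.

(** * Semicontinuity of slopes under limits *)

Section SlopeLimits.
Variables (U : set_system nat) (F : nat -> G -> R) (g : G -> R) (c : nat -> R).
Hypotheses (UU : UltraFilter U) (oU : \oo `<=` U) (MF : forall n, M (F n)) (Mg : M g)
  (Fg : forall y, ulim U (fun n => F n y + c n) (g y)).

Lemma limit_increment (y z : G) (e : R) : 0 < e ->
  U [set n | `|(F n z - F n y) - (g z - g y)| < e].
Proof.
move=> e0; have e20 : 0 < e / 2 by lra.
apply: filterS (filterI (Fg y e20) (Fg z e20)) => n /= [ny nz].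
rewrite (_ : _ - _ = (F n z + c n - g z) - (F n y + c n - g y)); last lra.
by apply: le_lt_trans (ler_normB _ _) _; lra.
Qed.

(* With [t_ n -> 0], an index drop of [F n] at distance [t_ n] from [x] is
   felt by the slope of the limit at [x] itself. *)
Lemma slope_limit_drop (x : G) (nu : tangent x) (t_ : nat -> R) (j : int) :
  (0 <= j <= 1) ->
  (forall e : R, 0 < e -> \forall n \near \oo, 0 < t_ n < e) ->
  (forall n m, rslope (on_dart (F n) (val nu)) (dart_pos x (val nu) + t_ n) m ->
     m <= slope (F n) nu - j) ->
  U [set n | slope g nu <= slope (F n) nu - j].
Proof.
move=> j01 t0 drop.
have [e e0 nice] := ray_nice_near nu.
have gr := admissible_rational adm Mg.
have [e' e'0 gP] := slope_rslope nu gr.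
set d := val nu in nice drop gP; set p := dart_pos x d in nice drop gP.
have [h [h0 he he']] : exists h, [/\ 0 < h, h < e & h < e'].
  exists (Num.min e e' / 2); have : 0 < Num.min e e' by rewrite lt_min e0.
  have [l1 l2] : Num.min e e' <= e /\ Num.min e e' <= e' by rewrite !ge_min !lexx orbT.
  by split; lra.
have h20 : 0 < h / 2 by lra.
have h40 : 0 < h / 4 by lra.
have ph : 0 < p + h < len d.1 by case: (nice h); rewrite ?h0.
have p0 : 0 <= p by case/andP: (dart_pos_itv (valP nu)).
(* The scale [h] is fixed first; then [n] is taken with increment error below [h / 2] and [t_ n]
   below [h / 4]. *)
apply: filterS (filterI (limit_increment x (dart_chart d (p + h)) h20) (oU (t0 _ h40))).
move=> n /= [nh /andP[tn0 tnh]].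
have fr := admissible_rational adm (MF n).
have conc s : p < s < p + e -> concave_at (on_dart (F n) d) s.
  move=> sp; rewrite (_ : s = p + (s - p)); last lra.
  by apply: ray_nice_concave => //; apply: nice; lra.
have plF := on_dart_pl d fr.
have [|m ms] := @pl_rslope _ _ _ (p + t_ n) plF; first lra.
have mle := drop n m ms.
have i1 : on_dart (F n) d (p + t_ n) - on_dart (F n) d p <=
    (slope (F n) nu)%:~R * (p + t_ n - p).
  have rs := slope_rslope nu fr; rewrite -/d -/p in rs.
  apply: (rslope_chord plF) rs; try lra.
  by move=> s sp; apply: conc; lra.
have i2 : on_dart (F n) d (p + h) - on_dart (F n) d (p + t_ n) <=
    m%:~R * (p + h - (p + t_ n)).
  apply: (rslope_chord plF) ms; try lra.
  by move=> s sp; apply: conc; lra.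
have gh := gP h; rewrite h0 he' in gh; have {}gh := gh isT.
have E f : f x = on_dart f d p by rewrite /on_dart dart_chart_pos // (valP nu).
rewrite !E -!/(on_dart _ _ _) ltr_norml in nh; have {nh} /andP[nh _] := nh.
have m1 : (m%:~R : R) <= (slope (F n) nu)%:~R - j%:~R by rewrite -intrB ler_int.
have j1 : (j%:~R : R) <= 1 by rewrite -[leRHS](mulr1z 1) ler_int; case/andP: j01.
have th : 0 < t_ n < h / 4 by rewrite tn0.
exact: int_lt_succ (drop_estimate h0 th j1 m1 nh gh i1 i2).
Qed.

(** The case [j = 0], for any distances tending to 0: concavity already makes slopes decrease away
    from [x]. *)
Lemma slope_limit_le (x : G) (nu : tangent x) :
  U [set n | slope g nu <= slope (F n) nu].
Proof.
have [e e0 nice] := ray_nice_near nu.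
have [t_ [te t0]] := shrinking_seq e0.
have /= := @slope_limit_drop x nu t_ 0 isT t0.
under eq_set do rewrite subr0; apply=> n m ms.
have fr := admissible_rational adm (MF n); have plF := on_dart_pl (val nu) fr.
have [ds _ _ _ _] := nice _ (te n).
have := dart_pos_itv (valP nu) => pos.
have [|m' ml] := @pl_lslope _ _ _ (dart_pos x (val nu) + t_ n) plF; first lra.
have mm' : m <= m' by apply: ray_nice_concave (MF n) (nice _ (te n)) _ _ ml ms.
rewrite subr0; apply: le_trans mm' _.
have tn := te n.
apply: (slope_antitone plF _ _ _ _ (slope_rslope nu fr) ml); try lra.
move=> s sp; rewrite (_ : s = dart_pos x (val nu) + (s - dart_pos x (val nu))); last lra.
by apply: ray_nice_concave => //; apply: nice; lra.
Qed.

End SlopeLimits.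
End Admissible.

(** * Uniqueness *)

Section JumpRealization.
Context {R : realType} (G : metric_graph R).
Variables (D : divisor G) (M : set (G -> R)) (r : nat) (S : slope_structure G r).
Hypothesis adm : admissible D M S.
Variable x : G.
Implicit Types (a b : cube r (tangent x)) (s : seq G).

Local Notation rho := (rank_at S (x := x)).

(** [s] is the divisor [E] of the overview. The size condition completes [rho b] copies of [x] to
    degree [r], so admissibility supplies a function to which the last clause applies. *)
Definition forces b s := [/\ jump rho b, (size s)%:Z + rho b = r%:Z &
  forall f, M f -> dominates S (nseq `|rho b|%N x ++ s) f -> slopes_at S f b].

Lemma forces0 : forces [ffun=> ord0] [::].
Proof.
have rk := rank_at_rank_function S x.
have [nu _] := exists_tangent x; have [j0 r0] := jump0 nu rk.
split=> [//||f Mf /(_ x)[a fa]]; first by rewrite r0.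
rewrite r0 cats0 count_nseq /= eqxx mul1n => /(rank_max_eq0 rk) aE.
by rewrite -aE.
Qed.

Lemma forces_step a b s : jump rho a -> forces b s -> cube_le b a -> b <> a ->
  exists b' s', [/\ forces b' s', cube_le b' a, cube_le b b' & b' <> b].
Proof.
move=> ja [jb sz fb] ba neq.
have rk := rank_at_rank_function S x; have [_ mono _ _] := rk.
have [|nu bnu] := @cube_not_le _ _ a b; first by move/(cube_le_anti ba).
have bnr : (b nu < r)%N := leq_trans bnu (leq_ord _).
pose c := cube_succ b nu.
have ca : cube_le c a := cube_succ_le ba bnu.
have rc : rho c = rho b - 1 by case: jb => _; exact.
have c0 : 0 <= rho c by apply: le_trans (mono _ _ ca); case: ja.
have [b' jb' [cb' rb']] := jump_above rk c0.
have [k kE] : exists k : nat, rho b = k.+1%:Z.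
  by exists `|rho c|%N; lia.
have kE' : rho b' = k%:Z by lia.
have [e e0 nice] := ray_nice_near D S nu.
have [t_ [te t0]] := shrinking_seq e0.
pose y_ n := dart_chart (val nu) (dart_pos x (val nu) + t_ n).
suff [n nP] : exists n, forall f, M f ->
    dominates S (nseq k x ++ y_ n :: s) f -> slopes_at S f b'.
  exists b', (y_ n :: s); split.
  - split=> //; first by rewrite kE' /=; lia.
    by rewrite kE'.
  - exact: (jump_closure_le rk ja ca cb' rb').
  - exact: cube_le_trans (cube_le_succ bnr) cb'.
  - by move=> E; rewrite E in rb'; lia.
apply: contrapT => none.
have ex n : exists f, [/\ M f, dominates S (nseq k x ++ y_ n :: s) f & ~ slopes_at S f b'].
  apply: contrapT => no; apply: none; exists n => f Mf df.
  by apply: contrapT => nf; apply: no; exists f.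
have [F FP] := choice ex.
have MF n : M (F n) by case: (FP n).
have dF n : dominates S (nseq k x ++ y_ n :: s) (F n) by case: (FP n).
have [U [g [c_ [UU oU Mg Fg]]]] := admissible_limit adm MF.
have le_slopes y : U [set n | forall mu : tangent y, slope g mu <= slope (F n) mu].
  apply: (@filter_forall _ _ (fun (mu : tangent y) n => slope g mu <= slope (F n) mu)).
  by move=> mu; exact: (slope_limit_le adm UU oU MF Mg Fg).
(* The requirement at [y_ n] costs one slope index there, and by concavity the slope just before
   [y_ n] is at most the one at [x]. *)
have drop : U [set n | slope g nu <= slope (F n) nu - 1].
  apply: (slope_limit_drop adm UU oU MF Mg Fg) t0 _ => // n m ms.
  have [an fan can] := dF n (y_ n).
  have [|i [j [ij rs ls]]] :=
    @ray_nice_slopes _ _ _ _ _ _ adm x nu _ _ 1 an (MF n) (nice _ (te n)) fan.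
    by apply: le_trans can; rewrite lez_nat count_cat /= eqxx addnS.
  rewrite (rslope_uniq ms rs).
  have jle : tangent_slope S nu j <= slope (F n) nu.
    have fr := admissible_rational adm (MF n).
    have [inn _ _ _ _] := nice _ (te n); have tn := te n.
    have pos := dart_pos_itv (valP nu).
    apply: (slope_antitone (on_dart_pl (val nu) fr) _ _ _ _ (slope_rslope nu fr) ls); try lra.
    move=> u up; rewrite (_ : u = dart_pos x (val nu) + (u - dart_pos x (val nu))); last lra.
    by apply: (ray_nice_concave adm (MF n)); apply: nice; lra.
  have : tangent_slope S nu i < tangent_slope S nu j by rewrite tangent_slope_lt; lia.
  by lia.
have [b1 gb1 jb1] := admissible_jump adm x Mg.
have [n [nle ndrop]] := filter_ex (filterI (le_slopes x) drop).
have [bn fbn cbn] := dF n x.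
have b1n : cube_le b1 bn.
  by move=> mu; rewrite -(tangent_slope_le S mu) -fbn -gb1; exact: nle.
have b1nu : (b1 nu < bn nu)%N.
  by rewrite -(tangent_slope_lt S nu) -fbn -gb1; have := ndrop; rewrite /=; lia.
have ynx : (y_ n == x) = false.
  apply/negbTE/eqP => E; have [inn _ _ _ _] := nice _ (te n).
  have tn := te n; have pos := dart_pos_itv (valP nu).
  have := @dart_chart_inj _ _ (val nu) (dart_pos x (val nu) + t_ n) (dart_pos x (val nu)).
  rewrite -/(y_ n) E (dart_chart_pos (valP nu)) => h.
  by have := h ltac:(lra) ltac:(lra) erefl; lra.
(* At [x] the slopes of [g] lie strictly below those of [F n], so its rank is higher by at least
   one, which makes up for the point moved to [y_ n]. Elsewhere lower slopes give at least the rank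
   required by [s]. *)
have bE : b1 = b.
  apply: (slopes_at_inj gb1); apply: fb => // y; rewrite kE /=.
  have [->|yx] := eqVneq y x.
    exists b1 => //.
    have b1bn : b1 <> bn by move=> E; move: b1nu; rewrite E ltnn.
    have := jump_lt rk jb1 b1n b1bn.
    move: cbn; rewrite !count_cat !count_nseq /= ynx eqxx !mul1n.
    by move: (rho b1) (rho bn) => u v; lia.
  have [ag gag _] := admissible_jump adm y Mg; exists ag => //.
  (* The index may depend on [y]: the part of the requirement coming from [s] is the same for all
     indices. *)
  have [m mle] := filter_ex (le_slopes y).
  have [am fam cam] := dF m y.
  have [_ mono_y _ _] := rank_at_rank_function S y.
  have : cube_le ag am.
    by move=> mu; rewrite -(tangent_slope_le S mu) -fam -gag; exact: mle.
  move/mono_y; apply: le_trans; apply: le_trans cam; rewrite lez_nat.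
  rewrite eq_sym in yx.
  by rewrite !count_cat !count_nseq /= (negbTE yx) !mul0n !add0n leq_addl.
have [_ _] := FP n; apply.
have [bn' fbn' jbn] := admissible_jump adm x (MF n).
have E := slopes_at_inj fbn fbn'; rewrite -{}E in fbn' jbn.
suff -> : b' = bn by [].
rewrite bE in b1n b1nu.
have cbn' : cube_le c bn := cube_succ_le b1n b1nu.
(* [bn] lies above [c] and has rank at least [k], the rank of [c]; so [bn] and [b'] are both the
   closure of [c]. *)
apply: (jump_closure_uniq rk jb' jbn cb' cbn' rb').
apply/eqP; rewrite eq_le mono //= rc kE.
by apply: le_trans cbn; rewrite count_cat count_nseq /= eqxx mul1n; lia.
Qed.

(** Climb from 0 to [a], the remaining coordinate distance being the measure. The final requirement
    has degree [r], so some [f] in [M] meets it. *)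
Lemma jump_realized a : jump rho a -> exists2 f, M f & slopes_at S f a.
Proof.
move=> ja.
suff [s [_ sz fa]] : exists s, forces a s.
  have [|f Mf df] := admissible_seq adm (s := nseq `|rho a|%N x ++ s).
    by rewrite size_cat size_nseq; case: ja => a0 _; lia.
  by exists f => //; exact: fa.
suff : forall n b s, (\sum_i (a i - b i) < n)%N -> forces b s -> cube_le b a ->
    exists s, forces a s.
  by move/(_ _ _ _ (ltnSn _) forces0); apply => i; rewrite ffunE.
elim=> // n IH b s bn fb ba.
have [<-|neq] := pselect (b = a); first by exists s.
have [b' [s' [fb' b'a bb' neq']]] := forces_step ja fb ba neq.
apply: (IH b' s') => //; rewrite -ltnS; apply: leq_trans bn; rewrite ltnS.
have [|i bi] := @cube_not_le _ _ b' b; first by move=> h; apply: neq'; exact: cube_le_anti.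
rewrite [ltnLHS](bigD1 i) //= [ltnRHS](bigD1 i) //= -addSn leq_add //.
  by apply: ltn_sub2l => //; exact: leq_trans bi (b'a i).
by apply: leq_sum => j _; rewrite leq_sub2l // bb'.
Qed.

End JumpRealization.

(** * Comparison of two slope structures of one semimodule *)

Section Uniqueness.
Context {R : realType} (G : metric_graph R) (D : divisor G) (M : set (G -> R)).

(** A slope of [S] is attained by some [f] in [M] at a point near [x] on the ray; there [f] is
    compatible with [S'], whose forward slopes are still those at [nu]. *)
Lemma slope_set_sub r r' (S : slope_structure G r) (S' : slope_structure G r')
    (x : G) (nu : tangent x) :
  admissible D M S -> admissible D M S' -> slope_set S nu `<=` slope_set S' nu.
Proof.
move=> adm adm' _ [i _ <-].
have [e e0 nice] := ray_nice_near D S' nu.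
have [f Mf [h he rs]] := realize_slope adm nu i e0.
have [ds fwd _ _ _] := nice h he.
have [[mu muE] _] := inner_tangents ds.
have [a fa _] := admissible_jump adm' (dart_chart (val nu) (dart_pos x (val nu) + h)) Mf.
exists (a mu) => //; rewrite -(fwd mu muE) -fa.
by apply: slopeE; rewrite muE dart_pos_inner.
Qed.

Lemma width_le r r' (S : slope_structure G r) (S' : slope_structure G r') :
  admissible D M S -> admissible D M S' -> (r <= r')%N.
Proof.
move=> adm adm'.
have /card_gt0P[e _] := edge_exists G; have [nu _] := exists_tangent (chart e 0).
have ex i : exists j, tangent_slope S' nu j = tangent_slope S nu i.
  have : slope_set S nu (tangent_slope S nu i) by exists i.
  by move=> /(slope_set_sub adm adm')[j _ ?]; exists j.
have [j jP] := choice ex.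
suff : injective j by move/leq_card; rewrite !card_ord.
by move=> i i' E; apply: (@tangent_slope_inj _ _ _ S _ nu); rewrite -!jP E.
Qed.

Lemma increasing_ord_ge r (j : 'I_r.+1 -> 'I_r.+1) :
  (forall i i' : 'I_r.+1, (i < i')%N -> (j i < j i')%N) ->
  forall i : 'I_r.+1, (i <= j i)%N.
Proof.
move=> jlt [n nr]; elim: n nr => [|n IH] nr //.
by apply: leq_ltn_trans (IH (ltnW nr)) _; exact: jlt.
Qed.

(** Inclusion of slope sets gives a strictly increasing map of indices, which never lowers an index.
    Used in both directions, this makes the two slope functions equal. *)
Lemma tangent_slope_ge r (S S' : slope_structure G r) (x : G) (nu : tangent x) i :
  admissible D M S -> admissible D M S' ->
  tangent_slope S' nu i <= tangent_slope S nu i.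
Proof.
move=> adm adm'.
have ex k : exists j, tangent_slope S' nu j = tangent_slope S nu k.
  have : slope_set S nu (tangent_slope S nu k) by exists k.
  by move=> /(slope_set_sub adm adm')[j _ ?]; exists j.
have [j jP] := choice ex; rewrite -jP tangent_slope_le.
apply: increasing_ord_ge => k k'.
by rewrite -(tangent_slope_lt S nu) -(tangent_slope_lt S' nu) !jP.
Qed.

Lemma jump_transfer r (S S' : slope_structure G r) (x : G) (a : cube r (tangent x)) :
  admissible D M S -> admissible D M S' ->
  jump (rank_at S (x := x)) a -> jump (rank_at S' (x := x)) a.
Proof.
move=> adm adm' ja; have [f Mf fa] := jump_realized adm ja.
have [a' fa' ja'] := admissible_jump adm' x Mf.
suff -> : a = a' by [].
apply: (slopes_at_inj fa) => nu; rewrite fa'; apply/eqP.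
by rewrite eq_le !tangent_slope_ge.
Qed.

End Uniqueness.

Theorem corollary1p3 (R : realType) (G : metric_graph R) (D : divisor G)
  (M : set (G -> R)) (r r' : nat)
  (SS : slope_structure G r) (SS' : slope_structure G r') :
  admissible D M SS -> admissible D M SS' -> same_slope_structure SS SS'.
Proof.
move=> adm adm'.
have rr : r = r' by apply/eqP; rewrite eqn_leq (width_le adm adm') (width_le adm' adm).
subst r'; exists erefl; split=> [x nu|x a].
  by apply/seteqP; split; [exact: slope_set_sub adm adm' | exact: slope_set_sub adm' adm].
rewrite (_ : [ffun _ => _] = a); last first.
  by apply/ffunP => nu; rewrite ffunE cast_ord_id.
(* This tangent is the coordinate along which the chains of jumps climb. *)
have [nu _] := exists_tangent x.
apply: (rank_eq_of_jumps nu); [exact: rank_at_rank_function..|] => b.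
by split; [exact: jump_transfer adm adm' | exact: jump_transfer adm' adm].
Qed.
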